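(* $$\widehat P(\widehat\phi)\le\max\Big\{h_{\widehat\nu\circ\pi^{-1}}(T)+\int\widehat\phi\,d\widehat\nu:\ \widehat\nu\text{ is an }\widehat F\text{-invariant Borel probability measure on }\Sigma\times X\Big\},$$ where $\pi:\Sigma\times X\to\Sigma$ is the projection and $h_{\widehat\nu\circ\pi^{-1}}(T)$ is the (Kolmogorov–Sinai) metric entropy of $T$ with respect to $\widehat\nu\circ\pi^{-1}$.
   Context: Setting: $\Sigma$ is a two-sided compact (finite alphabet), topologically transitive topological Markov shift with left shift $T:\Sigma\to\Sigma$; $X$ is a compact metric space; $\omega\mapsto F_\omega$ is a Hölder continuous map from $\Sigma$ into the space $C_\alpha(X,X)$ of $\alpha$-Hölder maps of $X$, where each $F_\omega$ is an $\alpha$-Hölder homeomorphism of $X$. The skew product is $\widehat F(\omega,t)=(T\omega,F_\omega(t))$ on $\Sigma\times X$. $\widehat\phi:\Sigma\times X\to\mathbb R$ is Hölder continuous and $\widehat\phi^{(n)}:=\sum_{k=0}^{n-1}\widehat\phi\circ\widehat F^k$. Words: $\underline w=(w_0,\dots,w_{n-1})$ ranges over admissible words of length $|\underline w|=n$, with $[\underline w]=\{\omega\in\Sigma:\omega_i=w_i,\ 0\le i\le n-1\}$. Pressure out of equilibrium (POE): $$\widehat P(\widehat\phi):=\limsup_{n\to\infty}\sup_{t\in X}\frac1n\log\sum_{|\underline w|=n}e^{\widehat\phi^{(n)}(\theta_{\underline w},t)},$$ where $\theta_{\underline w}=\theta_{\underline w}(t)\in[\underline w]$ maximizes $\omega\mapsto\widehat\phi^{(n)}(\omega,t)$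 on $[\underline w]$. *)

(* Defs.v *)
From HB Require Import structures.
From mathcomp Require Import all_boot all_order all_algebra.
From mathcomp Require Import all_classical all_reals all_analysis.

Set Implicit Arguments.
Unset Strict Implicit.
Unset Printing Implicit Defensive.

Import Order.TTheory GRing.Theory Num.Theory.
Import numFieldNormedType.Exports.

Local Open Scope classical_set_scope.
Local Open Scope ring_scope.

#[short(type="pmetricType")]
HB.structure Definition PointedMetric (R : numDomainType) :=
  {M of Pointed M & Metric R M}.

Section prod_metric.
Context {R : realType} (U V : metricType R).

Definition prod_mdist (x y : U * V) : R :=
  Num.max (mdist x.1 y.1) (mdist x.2 y.2).

Lemma prod_mdist_ge0 x y : 0 <= prod_mdist x y.
Proof. by rewrite le_max mdist_ge0. Qed.

Lemma prod_mdist_positivity x y : prod_mdist x y = 0 -> x = y.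
Proof.
case: x y => [x1 x2] [y1 y2]; rewrite /prod_mdist /= => e.
have h1 : mdist x1 y1 <= 0 by rewrite -e le_max lexx.
have h2 : mdist x2 y2 <= 0 by rewrite -e le_max lexx orbT.
congr (_, _); apply: mdist_positivity; apply/eqP;
  by rewrite eq_le mdist_ge0 ?h1 ?h2.
Qed.

Lemma ball_prod_mdist (x : U * V) (d : R) :
  ball x d = [set y | prod_mdist x y < d].
Proof.
case: x => [x1 x2]; apply/seteqP; split => -[y1 y2] /=;
  rewrite /prod_mdist gt_max /ball /= /prod_ball /= !ballEmdist /=.
- by move=> [-> ->].
- by move/andP.
Qed.

HB.instance Definition _ := @PseudoMetric_isMetric.Build R (U * V)%type
  prod_mdist prod_mdist_ge0 prod_mdist_positivity ball_prod_mdist.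

End prod_metric.

(* The distances are explicit because the sup-distance [sup_mdist] below is not
   attached to a metricType. *)
Definition hoelder_for {R : realType} (U V : Type) (dU : U -> U -> R)
    (dV : V -> V -> R) (a : R) (f : U -> V) :=
  exists C : R, forall x y, dV (f x) (f y) <= C * dU x y `^ a.

Definition hoelder {R : realType} (U V : metricType R) (a : R) (f : U -> V) :=
  hoelder_for (@mdist R U) (@mdist R V) a f.

Definition hoelder_continuous {R : realType} (U V : metricType R)
    (f : U -> V) :=
  exists a : R, [/\ 0 < a, a <= 1 & hoelder a f].

Definition homeomorphism (U V : topologicalType) (f : U -> V) :=
  continuous f /\ exists g : V -> U, [/\ cancel f g, cancel g f & continuous g].

(* The uniform distance on the space of alpha-Hoelder maps; the supremum is
   finite as soon as V is compact. *)
Definition sup_mdist {R : realType} (U : Type) (V : metricType R)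
    (f g : U -> V) : R :=
  sup [set mdist (f x) (g x) | x in [set: U]].

(* F : U -> C_alpha(X, X), as a map into the self-maps of X that takes
   alpha-Hoelder values. *)
Definition hoelder_into_C_alpha {R : realType} (U X : metricType R) (alpha : R)
    (F : U -> X -> X) :=
  (forall w, hoelder alpha (F w)) /\
  exists a : R,
    [/\ 0 < a, a <= 1 & hoelder_for (@mdist R U) (@sup_mdist R X X) a F].

Definition topologically_transitive (U : topologicalType) (f : U -> U) :=
  forall A B : set U, open A -> open B -> A !=set0 -> B !=set0 ->
    exists n, (iter n f @` A) `&` B !=set0.

(* Transition rules whose shift space is nonempty. *)
Record transition (A : finType) := Transition {
  trans_rel :> rel A;
  trans_ne : exists w : int -> A, forall i : int, trans_rel (w i) (w (i + 1)) }.

(* The parameter R is the field in which the metric takes its values. *)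
Record markov_shift (R : realType) (A : finType) (M : transition A) :=
  MarkovShift {
    coords :> int -> A;
    coordsP : forall i : int, M (coords i) (coords (i + 1)) }.

Section markov_shift.
Context {R : realType} {A : finType} {M : transition A}.
Local Notation Sigma := (markov_shift R M).

Lemma coords_inj (w w' : Sigma) : (forall i, w i = w' i) -> w = w'.
Proof.
case: w w' => [w wP] [w' w'P] /= /funext e.
by case: _ / e w'P => w'P; congr MarkovShift; exact: Prop_irrelevance.
Qed.

HB.instance Definition _ := gen_eqMixin Sigma.
HB.instance Definition _ := gen_choiceMixin Sigma.

Definition shift_point : Sigma :=
  MarkovShift R (projT2 (cid (trans_ne M))).

HB.instance Definition _ := isPointed.Build Sigma shift_point.

Definition differ_at (w w' : Sigma) : pred nat :=
  fun n => (w n%:Z != w' n%:Z) || (w (- n%:Z) != w' (- n%:Z)).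

(* 2 ^ - min {|i| : w i <> w' i} *)
Definition shift_mdist (w w' : Sigma) : R :=
  if pselect (exists n, differ_at w w' n) is left e then 2 ^- (ex_minn e)
  else 0.

Lemma shift_mdistxx (w : Sigma) : shift_mdist w w = 0.
Proof.
rewrite /shift_mdist; case: pselect => // e; exfalso; case: e => n.
by rewrite /differ_at !eqxx.
Qed.

Lemma shift_mdist_positivity (w w' : Sigma) : shift_mdist w w' = 0 -> w = w'.
Proof.
rewrite /shift_mdist; case: pselect => [e|ne].
  by move/eqP; rewrite invr_eq0 expf_eq0 pnatr_eq0 andbF.
move=> _; apply: coords_inj => i; apply: contrapT => /eqP wi; apply: ne.
exists `|i|%N; rewrite /differ_at; case: i wi => n wi /=.
  by rewrite wi.
by rewrite -NegzE wi orbT.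
Qed.

Lemma shift_mdist_sym (w w' : Sigma) : shift_mdist w w' = shift_mdist w' w.
Proof.
have h : differ_at w w' = differ_at w' w.
  by apply/funext => n; rewrite /differ_at eq_sym (eq_sym (w (- _))).
by rewrite /shift_mdist h.
Qed.

Lemma shift_mdist_ge0 (w w' : Sigma) : 0 <= shift_mdist w w'.
Proof.
by rewrite /shift_mdist; case: pselect => // e; rewrite invr_ge0 exprn_ge0.
Qed.

Lemma shift_mdist_triangle (y x z : Sigma) :
  shift_mdist x z <= shift_mdist x y + shift_mdist y z.
Proof.
rewrite {1}/shift_mdist; case: pselect => [e|ne]; last first.
  by rewrite addr_ge0 ?shift_mdist_ge0.
case: ex_minnP => n dn _.
have : differ_at x y n || differ_at y z n.
  rewrite -[_ || _]negbK negb_or; apply/negP; rewrite /differ_at !negb_or !negbK.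
  move=> /andP[/andP[/eqP e1 /eqP e2] /andP[/eqP e3 /eqP e4]].
  by move: dn; rewrite /differ_at e1 e2 e3 e4 !eqxx.
have aux (u v : Sigma) : differ_at u v n -> 2 ^- n <= shift_mdist u v.
  rewrite /shift_mdist => d; case: pselect => [e'|[]]; last by exists n.
  case: ex_minnP => k _ kmin.
  by rewrite lef_pV2 ?posrE ?exprn_gt0// ler_eXn2l ?ltr1n// kmin.
case/orP => /aux h; apply: (le_trans h).
  by rewrite lerDl shift_mdist_ge0.
by rewrite lerDr shift_mdist_ge0.
Qed.

HB.instance Definition _ := @isMetric.Build R Sigma shift_mdist
  shift_mdistxx shift_mdist_positivity shift_mdist_sym shift_mdist_triangle.

Lemma left_shift_subproof (w : Sigma) (i : int) :
  M (w (i + 1)) (w (i + 1 + 1)).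
Proof. exact: coordsP. Qed.

Definition left_shift (w : Sigma) : Sigma :=
  @MarkovShift R A M (fun i => w (i + 1)) (left_shift_subproof w).

Definition cylinder n (u : n.-tuple A) : set Sigma :=
  [set w | forall i : 'I_n, w i%:Z = tnth u i].

Definition admissible n (u : n.-tuple A) : Prop := cylinder u !=set0.

End markov_shift.

HB.instance Definition _ (U V : ptopologicalType) := Pointed.on (U * V)%type.

Definition borel (T : ptopologicalType) := g_sigma_algebraType (@open T).

Section entropy.
Context d {S : measurableType d} {R : realType}.
Variables (T : S -> S) (m : set S -> \bar R).

Definition measurable_partition k (P : 'I_k -> set S) :=
  (forall i, measurable (P i)) /\ classical_sets.partition [set: 'I_k] P [set: S].

(* Cells may be empty: they contribute 0 since ln 0 = 0. *)
Definition partition_entropy (I : finType) (P : I -> set S) : R :=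
  - \sum_(i : I) fine (m (P i)) * ln (fine (m (P i))).

(* The join of P, T^-1 P, ..., T^-(n-1) P, indexed by itineraries. *)
Definition dynamical_join k (P : 'I_k -> set S) n (u : n.-tuple 'I_k) : set S :=
  \bigcap_(j in [set: 'I_n]) (iter j T @^-1` P (tnth u j)).

Definition entropy_wrt k (P : 'I_k -> set S) : R :=
  limn (fun n => n%:R^-1 * partition_entropy (@dynamical_join k P n)).

Definition metric_entropy : \bar R :=
  ereal_sup [set h | exists k (P : 'I_k -> set S),
    measurable_partition P /\ h = (entropy_wrt P)%:E].

Definition invariant_measure :=
  forall B : set S, measurable B -> m (T @^-1` B) = m B.

End entropy.

Section skew_product.
Context {R : realType} {A : finType} {M : transition A} {X : pmetricType R}.
Local Notation Sigma := (markov_shift R M).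

Definition skew_product (F : Sigma -> X -> X) (z : Sigma * X) : Sigma * X :=
  (left_shift z.1, F z.1 z.2).

Definition birkhoff_sum (F : Sigma -> X -> X) (phi : Sigma * X -> R) n
    (z : Sigma * X) : R :=
  \sum_(k < n) phi (iter k (skew_product F) z).

(* When phi and F are continuous a maximizer exists for every admissible u, by
   compactness of the cylinder; the default value is used otherwise. *)
Definition theta (F : Sigma -> X -> X) (phi : Sigma * X -> R) n
    (u : n.-tuple A) (t : X) : Sigma :=
  xget point [set w | cylinder u w /\ forall w', cylinder u w' ->
    birkhoff_sum F phi n (w', t) <= birkhoff_sum F phi n (w, t)].

Definition poe (F : Sigma -> X -> X) (phi : Sigma * X -> R) : \bar R :=
  limn_esup (fun n => ereal_sup [set
    (n%:R^-1 * ln (\sum_(u : n.-tuple A | `[< @admissible R A M n u >])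
       expR (birkhoff_sum F phi n (theta F phi u t, t))))%:E | t in [set: X]]).

(* h_{nu o pi^-1}(T) + \int phi dnu *)
Definition fiber_free_energy (phi : Sigma * X -> R)
    (nu : probability (borel (Sigma * X)%type) R) : \bar R :=
  (metric_entropy (left_shift : borel Sigma -> borel Sigma)
    (pushforward nu (fst : borel (Sigma * X)%type -> borel Sigma))
  + \int[nu]_z (phi z)%:E)%E.

End skew_product.

(* Main.v *)
(* A maximizing measure exists because the free energy is upper semicontinuous
   along ultralimits of invariant measures: the letter at 0 generates, so the
   entropy of T is the infimum over n of H(letters 0 .. n-1) / n, and cylinders
   are clopen.  For the inequality, give the points (theta_w, t) the Gibbs weights
   proportional to exp(phi^(n)); each cylinder of length n carries a single point,
   whence log sum_w exp(phi^(n)) = H + int phi^(n).  Averaging along the orbit as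
   in Misiurewicz's proof of the variational principle, an ultralimit of these
   measures is invariant and has at least the limiting free energy.  The limit
   measure itself is the regularization of the finitely additive ultralimit:
   inner approximation of open sets by closed sets, then an outer measure. *)
From HB Require Import structures.
Require Import Defs.
From mathcomp Require Import all_boot all_order all_algebra.
From mathcomp Require Import all_classical all_reals all_analysis.
From mathcomp Require Import measurable_realfun lra ring zify.

Set Implicit Arguments.
Unset Strict Implicit.
Unset Printing Implicit Defensive.

Import Order.TTheory GRing.Theory Num.Theory.
Import numFieldNormedType.Exports.

Local Open Scope classical_set_scope.
Local Open Scope ring_scope.

(** * Entropy of finite-valued functions *)

(** The fibre maps may carry entropy of their own, but only the entropy of the projection is
    counted. It is read off itineraries of the base letter, whose cells are clopen in the product,
    so nothing about the fibre dynamics beyond continuity enters the limit. Limits are taken setwise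
    along an ultrafilter, where every bounded real family converges. A setwise limit of measures is
    only finitely additive; hence the entropy inequalities are proved for finitely additive set
    functions, and integrals are replaced by finite sums over closed superlevel sets. Probabilities,
    averages of point masses and ultralimits are then treated alike. Regularization preserves only
    one-sided bounds: closed sets may gain mass. This is the direction required, since both terms of
    the free energy have to be bounded above by those of the limit. The same limit statement serves
    twice: over the integers for the Gibbs averages, and over the set of all probabilities, with the
    identity family, for the existence of a maximum. *)

Section ln_inequalities.
Context {R : realType}.
Implicit Types x y z e : R.

Lemma ln_le_subr1 x : 0 < x -> ln x <= x - 1.
Proof.
move=> x0; have -> : ln x = ln (1 + (x - 1)) by congr ln; lra.
by apply: le_ln1Dx; lra.
Qed.

(** Tangent-line bound for [ln] at 1, applied to z / y. It is the single convexity input behind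
    strong subadditivity, concavity and semicontinuity of entropy. The implication is absolute
    continuity: the convention [ln 0 = 0] would break the bound at z = 0 < y. *)
Lemma mulr_ln_sub_le y z : 0 <= y -> 0 <= z -> (0 < y -> 0 < z) ->
  y * (ln z - ln y) <= z - y.
Proof.
rewrite le_eqVlt => /orP[/eqP <- z0 _|y0 _ /(_ y0) z0]; first by rewrite mul0r subr0.
rewrite -ln_div ?posrE//.
have := ln_le_subr1 (divr_gt0 z0 y0).
rewrite -(ler_pM2l y0) => /le_trans; apply.
by rewrite mulrBr mulr1 mulrCA divff ?gt_eqF// mulr1.
Qed.

(* Twice [ln sqrt(z / y) <= sqrt(z / y) - 1], then AM-GM. *)
Lemma mulr_ln_sub_le_eps e y z : 0 < e -> 0 <= y -> y <= z ->
  y * (ln z - ln y) <= y / e + e * z.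
Proof.
move=> e0; rewrite le_eqVlt => /orP[/eqP <-|y0] yz.
  by rewrite mul0r mul0r add0r mulr_ge0// ltW.
have z0 : 0 < z by apply: lt_le_trans yz.
rewrite -ln_div ?posrE//; set r := z / y.
have r0 : 0 < r by rewrite divr_gt0.
have -> : y / e + e * z = y * (e^-1 + e * r).
  by rewrite /r; field; rewrite !gt_eqF.
rewrite ler_pM2l//.
have s0 : 0 < Num.sqrt r by rewrite sqrtr_gt0.
have es : Num.sqrt r ^+ 2 = r by rewrite sqr_sqrtr// ltW.
have -> : ln r = ln (Num.sqrt r) *+ 2 by rewrite -lnXn// es.
have h := ln_le_subr1 s0; set s := Num.sqrt r in s0 es h *.
have ei0 : 0 < e^-1 by rewrite invr_gt0.
have : 0 <= (e * s - 1) ^+ 2 * e^-1 by rewrite mulr_ge0// ?sqr_ge0// ltW.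
have -> : (e * s - 1) ^+ 2 * e^-1 = e * r + e^-1 - s *+ 2.
  by rewrite -es; field; rewrite gt_eqF.
move: h; set l := ln s; lra.
Qed.

Lemma mulr_lnN_le1 y : 0 <= y -> - (y * ln y) <= 1.
Proof.
move=> y0; have := @mulr_ln_sub_le y 1 y0 ler01 (fun=> ltr01).
rewrite ln1 sub0r mulrN; lra.
Qed.

End ln_inequalities.

Section discrete.
Context {R : realType} (I J K : finType) (p : I -> J -> K -> R).
Hypothesis p0 : forall i j k, 0 <= p i j k.
Let a i k := \sum_j p i j k.
Let b j k := \sum_i p i j k.
Let c k := \sum_i \sum_j p i j k.

(** Nonnegativity of the conditional mutual information of the first two coordinates given the
    third. Termwise, p is compared with a b / c, the coupling that is conditionally independent
    given k; both have total mass \sum_k c k. *)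
Lemma strong_subadditivity_sum : \sum_i \sum_j \sum_k
  p i j k * (ln (a i k) + ln (b j k) - ln (c k) - ln (p i j k)) <= 0.
Proof.
have a0 i k : 0 <= a i k by exact: sumr_ge0.
have b0 j k : 0 <= b j k by exact: sumr_ge0.
have c0 k : 0 <= c k by apply: sumr_ge0 => i _; exact: sumr_ge0.
have pa i j k : p i j k <= a i k.
  by rewrite /a (bigD1 j)//= lerDl; apply: sumr_ge0.
have pb i j k : p i j k <= b j k.
  by rewrite /b (bigD1 i)//= lerDl; apply: sumr_ge0.
have ac i k : a i k <= c k.
  by rewrite /c (bigD1 i)//= lerDl; apply: sumr_ge0 => ? _; exact: sumr_ge0.
have H i j k : p i j k * (ln (a i k) + ln (b j k) - ln (c k) - ln (p i j k))
    <= a i k * b j k / c k - p i j k.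
  have [pp|] := ltrP 0 (p i j k); last first.
    move=> h; have -> : p i j k = 0 by apply/eqP; rewrite eq_le h p0.
    by rewrite mul0r subr0 divr_ge0// mulr_ge0.
  have pa' := lt_le_trans pp (pa i j k); have pb' := lt_le_trans pp (pb i j k).
  have pc' := lt_le_trans pa' (ac i k).
  have -> : ln (a i k) + ln (b j k) - ln (c k) = ln (a i k * b j k / c k).
    by rewrite ln_div ?posrE ?mulr_gt0// lnM ?posrE.
  by apply: mulr_ln_sub_le => [||_]; rewrite ?divr_ge0 ?mulr_ge0 ?divr_gt0 ?mulr_gt0.
apply: (@le_trans _ _ (\sum_i \sum_j \sum_k (a i k * b j k / c k - p i j k))).
  by do 3!(apply: ler_sum => ? _).
have -> : \sum_i \sum_j \sum_k (a i k * b j k / c k - p i j k) =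
    \sum_i \sum_j \sum_k (a i k * b j k / c k) - \sum_i \sum_j \sum_k p i j k.
  by under eq_bigr do (under eq_bigr do rewrite sumrB; rewrite sumrB); rewrite sumrB.
rewrite subr_le0.
under eq_bigr do rewrite exchange_big/=; rewrite exchange_big/=.
under [leRHS]eq_bigr do rewrite exchange_big/=; rewrite [leRHS]exchange_big/=.
apply: ler_sum => k _.
under eq_bigr do rewrite -mulr_suml -mulr_sumr.
rewrite -mulr_suml -mulr_suml.
have -> : \sum_j b j k = c k by rewrite /b exchange_big.
have -> : \sum_i a i k = c k by [].
have [->|ck] := eqVneq (c k) 0; first by rewrite !mul0r.
by rewrite mulfK.
Qed.

End discrete.

Section finitely_additive.
Context d {S : measurableType d} {R : realType}.
Implicit Types (mu : set S -> R) (B C : set S).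

Definition fprob mu := [/\ mu [set: S] = 1,
  forall B, measurable B -> 0 <= mu B &
  forall B C, measurable B -> measurable C -> B `&` C = set0 ->
    mu (B `|` C) = mu B + mu C].

(* Finite-valued measurable functions stand for finite measurable partitions. *)
Definition labelling (I : finType) (f : S -> I) :=
  forall B : set I, measurable (f @^-1` B).

Definition ent mu (I : finType) (f : S -> I) : R :=
  - \sum_i mu (f @^-1` [set i]) * ln (mu (f @^-1` [set i])).

Lemma labelling1 (I : finType) (f : S -> I) : (forall i, measurable (f @^-1` [set i])) ->
  labelling f.
Proof.
move=> h B; have -> : f @^-1` B = \bigcup_(i in B) f @^-1` [set i].
  by apply/seteqP; split => s /=; [exists (f s)|case=> i Bi ->].
by apply: fin_bigcup_measurable => //; exact: finite_finset.
Qed.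

Lemma labelling_comp (I J : finType) (g : I -> J) (f : S -> I) : labelling f ->
  labelling (g \o f).
Proof. by move=> h B; rewrite comp_preimage. Qed.

Lemma labelling_pair (I J : finType) (f : S -> I) (g : S -> J) : labelling f -> labelling g ->
  labelling (fun s => (f s, g s)).
Proof.
move=> hf hg; apply: labelling1 => -[i j].
have -> : (fun s => (f s, g s)) @^-1` [set (i, j)] =
    f @^-1` [set i] `&` g @^-1` [set j].
  by apply/seteqP; split => s /= [<- <-].
exact: measurableI.
Qed.

Section fprob_theory.
Context (mu : set S -> R) (hmu : fprob mu).

Lemma fprob_ge0 B : measurable B -> 0 <= mu B. Proof. by case: hmu => _ + _; apply. Qed.

Lemma fprobU B C : measurable B -> measurable C -> B `&` C = set0 ->
  mu (B `|` C) = mu B + mu C.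
Proof. by case: hmu => _ _; apply. Qed.

Lemma fprob0 : mu set0 = 0.
Proof.
have := @fprobU set0 set0 measurable0 measurable0 (setI0 _); rewrite setU0; lra.
Qed.

Lemma fprob_sub B C : measurable B -> measurable C -> B `<=` C -> mu B <= mu C.
Proof.
move=> mB mC BC; rewrite -(setDUK BC) fprobU ?setDIK//; last exact: measurableD.
by rewrite lerDl fprob_ge0//; exact: measurableD.
Qed.

Lemma fprob_le1 B : measurable B -> mu B <= 1.
Proof. by move=> mB; case: (hmu) => <- _ _; apply: fprob_sub. Qed.

Lemma fprobC B : measurable B -> mu (~` B) = 1 - mu B.
Proof.
move=> mB; case: (hmu) => <- _ _; rewrite -(setUv B) fprobU ?setICr//.
  by rewrite addrAC subrr add0r.
exact: measurableC.
Qed.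

Lemma fprob_leU B C : measurable B -> measurable C ->
  mu (B `|` C) <= mu B + mu C.
Proof.
move=> mB mC.
have -> : B `|` C = B `|` (C `\` B) by rewrite setUDr setDv setD0.
rewrite fprobU ?setDIK//; last exact: measurableD.
by rewrite lerD2l; apply: fprob_sub => //; exact: measurableD.
Qed.

Lemma fprob_splitI (I : finType) (f : S -> I) (hf : labelling f) (Q : pred I) B :
  measurable B -> mu (B `&` f @^-1` [set i | Q i]) =
  \sum_(i | Q i) mu (B `&` f @^-1` [set i]).
Proof.
move=> mB; rewrite -big_filter.
have -> : [set i | Q i] = [set i | i \in [seq i <- index_enum I | Q i]].
  by apply/seteqP; split => i /=; rewrite mem_filter mem_index_enum andbT.
have : uniq [seq i <- index_enum I | Q i] by rewrite filter_uniq// index_enum_uniq.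
elim: [seq i <- index_enum I | Q i] => [_|i s IH /= /andP[si us]].
  by rewrite big_nil -[RHS]fprob0; congr mu; apply/seteqP; split => // x [].
rewrite big_cons -IH// -fprobU//; [|exact: measurableI..|].
- congr mu; rewrite -setIUr; congr (_ `&` _); apply/seteqP; split => x /=; rewrite inE.
    by move=> /orP[/eqP|]; [left|right].
  by case=> ->; rewrite ?eqxx ?orbT.
- by apply/seteqP; split => // x [[_ /= ->] [_ h]]; rewrite h in si.
Qed.

Lemma fprob_split (I : finType) (f : S -> I) (hf : labelling f) (Q : pred I) :
  mu (f @^-1` [set i | Q i]) = \sum_(i | Q i) mu (f @^-1` [set i]).
Proof.
by have := fprob_splitI hf Q measurableT; under eq_bigr do rewrite setTI; rewrite setTI.
Qed.

Lemma fprob_marginal (I J : finType) (f : S -> I) (g : S -> J) (h : I -> J)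
    (hf : labelling f) : (forall s, g s = h (f s)) -> forall j,
  mu (g @^-1` [set j]) = \sum_(i | h i == j) mu (f @^-1` [set i]).
Proof.
move=> e j; rewrite -fprob_split//; congr mu; apply/seteqP.
by split => s /=; rewrite e => /eqP.
Qed.

Lemma fprob_sum1 (I : finType) (f : S -> I) (hf : labelling f) :
  \sum_i mu (f @^-1` [set i]) = 1.
Proof. by rewrite -fprob_split//; case: hmu => <- _ _; congr mu; apply/seteqP. Qed.

Lemma ent_ge0 (I : finType) (f : S -> I) : labelling f -> 0 <= ent mu f.
Proof.
move=> hf; rewrite /ent -sumrN; apply: sumr_ge0 => i _.
by rewrite -mulrN mulr_ge0 ?fprob_ge0// oppr_ge0 ln_le0 ?fprob_le1.
Qed.

(** Each term is at most 1. This is cruder than [ln #|I|], but only a bound independent of [mu] is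
    required. *)
Lemma ent_le_card (I : finType) (f : S -> I) : labelling f ->
  ent mu f <= #|I|%:R.
Proof.
move=> hf; rewrite /ent -sumrN -sum1_card natr_sum; apply: ler_sum => i _.
by apply: mulr_lnN_le1; exact: fprob_ge0.
Qed.

(* [ent mu f] as an expectation over a finer labelling [g]. *)
Lemma ent_refine (I J : finType) (f : S -> I) (g : S -> J) (h : J -> I)
    (hg : labelling g) : (forall s, f s = h (g s)) ->
  ent mu f = - \sum_j mu (g @^-1` [set j]) * ln (mu (f @^-1` [set h j])).
Proof.
move=> e; rewrite /ent (partition_big h xpredT)//=; congr (- _).
apply: eq_bigr => i _; rewrite {1}(fprob_marginal hg e) mulr_suml.
by apply: eq_bigr => j /eqP ->.
Qed.

Lemma ent_comp_le (I J : finType) (f : S -> I) (g : S -> J) (h : J -> I)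
    (hg : labelling g) : (forall s, f s = h (g s)) -> ent mu f <= ent mu g.
Proof.
move=> e; rewrite (ent_refine hg e) /ent lerN2; apply: ler_sum => j _.
have hf : labelling f by rewrite (_ : f = h \o g) ?funeqE//; exact: labelling_comp.
have [g0|] := ltrP 0 (mu (g @^-1` [set j])); last first.
  move=> g0; have -> : mu (g @^-1` [set j]) = 0; last by rewrite !mul0r.
  by apply/eqP; rewrite eq_le g0 fprob_ge0.
have gf : mu (g @^-1` [set j]) <= mu (f @^-1` [set h j]).
  by apply: fprob_sub => // s /=; rewrite e => ->.
by rewrite ler_pM2l// ler_ln ?posrE//; apply: lt_le_trans gf.
Qed.

(** Phrasing refinement through fibres spares every caller a factor map; here one is obtained by
    choosing a point in each fibre of [g]. *)
Lemma ent_le (I J : finType) (f : S -> I) (g : S -> J) (hg : labelling g) :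
  (forall s s', g s = g s' -> f s = f s') -> ent mu f <= ent mu g.
Proof.
move=> e; apply: (@ent_comp_le _ _ _ _ (fun j => f (xget point (g @^-1` [set j])))) => //.
by move=> s; apply: e; apply/esym; exact: (@xgetI _ point (g @^-1` [set g s]) s).
Qed.

Lemma ent_eq (I J : finType) (f : S -> I) (g : S -> J) (hf : labelling f)
    (hg : labelling g) :
  (forall s s', g s = g s' <-> f s = f s') -> ent mu f = ent mu g.
Proof.
by move=> e; apply: le_anti; apply/andP; split; apply: ent_le => // s s' /e.
Qed.

(** By [ent_refine] all four entropies become expectations over the triple, and their difference is
    the sum in [strong_subadditivity_sum]. *)
Lemma ent_strong_subadditive (I J K : finType) (f : S -> I) (g : S -> J)
    (h : S -> K) (hf : labelling f) (hg : labelling g) (hh : labelling h) :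
  ent mu (fun s => (f s, g s, h s)) + ent mu h <=
  ent mu (fun s => (f s, h s)) + ent mu (fun s => (g s, h s)).
Proof.
set t := fun s => (f s, g s, h s).
have ht : labelling t by do !apply: labelling_pair.
rewrite (@ent_refine _ _ h t (fun x => x.2))//.
rewrite (@ent_refine _ _ (fun s => (f s, h s)) t (fun x => (x.1.1, x.2)))//.
rewrite (@ent_refine _ _ (fun s => (g s, h s)) t (fun x => (x.1.2, x.2)))//.
pose p i j k := mu (t @^-1` [set (i, j, k)]).
have p0 i j k : 0 <= p i j k by apply: fprob_ge0; exact: ht.
have := strong_subadditivity_sum p0.
have ea i k : \sum_j p i j k = mu ((fun s => (f s, h s)) @^-1` [set (i, k)]).
  rewrite (@fprob_marginal _ _ t _ (fun x => (x.1.1, x.2)) ht)//.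
  rewrite (reindex_onto (fun j => (i, j, k)) (fun x => x.1.2))/=; last first.
    by move=> [[i' j'] k'] /=/eqP[-> ->].
  by apply: eq_bigl => j; rewrite !eqxx.
have eb j k : \sum_i p i j k = mu ((fun s => (g s, h s)) @^-1` [set (j, k)]).
  rewrite (@fprob_marginal _ _ t _ (fun x => (x.1.2, x.2)) ht)//.
  rewrite (reindex_onto (fun i => (i, j, k)) (fun x => x.1.1))/=; last first.
    by move=> [[i' j'] k'] /=/eqP[-> ->].
  by apply: eq_bigl => i; rewrite !eqxx.
have ec k : \sum_i \sum_j p i j k = mu (h @^-1` [set k]).
  rewrite (@fprob_marginal _ _ t _ (fun x => x.2) ht)// pair_bigA/=.
  rewrite (reindex_onto (fun ij => (ij, k)) (fun x => x.1))/=; last first.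
    by move=> [[i' j'] k'] /=/eqP ->.
  by apply: eq_big => [[i j]|[i j] _]; rewrite ?eqxx.
under eq_bigr do under eq_bigr do under eq_bigr do rewrite ea eb ec.
have E (w : I * J * K -> R) :
    \sum_i \sum_j \sum_k w (i, j, k) = \sum_x w x.
  by rewrite pair_bigA/= pair_bigA/=; apply: eq_bigr => -[[]].
rewrite (E (fun x => p x.1.1 x.1.2 x.2 * (ln (mu ((fun s => (f s, h s)) @^-1` [set (x.1.1, x.2)]))
  + ln (mu ((fun s => (g s, h s)) @^-1` [set (x.1.2, x.2)])) - ln (mu (h @^-1` [set x.2]))
  - ln (p x.1.1 x.1.2 x.2)))).
move=> H; rewrite /ent -!opprD lerN2 -!big_split/= -subr_le0 -sumrB.
apply: le_trans H; rewrite le_eqVlt; apply/orP; left; apply/eqP.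
by apply: eq_bigr => -[[i j] k] _ /=; rewrite /p; ring.
Qed.

(* H(f | g) is small when the fibres of f are close to unions [E i] of fibres
   of g. *)
Lemma ent_pair_approx (I J : finType) (f : S -> I) (g : S -> J) (E : I -> set S) e :
  labelling f -> labelling g -> (forall i, measurable (E i)) -> 0 < e ->
  (forall i s s', g s = g s' -> E i s -> E i s') ->
  ent mu (fun s => (f s, g s)) - ent mu g <=
  \sum_i (mu (E i `\` f @^-1` [set i]) + mu (f @^-1` [set i] `\` E i) / e + e).
Proof.
move=> hf hg mE e0 Eg; have hfg := labelling_pair hf hg.
pose Q i := f @^-1` [set i]; pose G j := g @^-1` [set j].
have mQ i : measurable (Q i) by exact: hf.
have mG j : measurable (G j) by exact: hg.
rewrite (@ent_refine _ _ g (fun s => (f s, g s)) snd)// /ent opprK addrC -sumrB.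
have pE i j : (fun s => (f s, g s)) @^-1` [set (i, j)] = Q i `&` G j.
  by apply/seteqP; split => s /= [<- <-].
apply: (@le_trans _ _ (\sum_i \sum_j (mu ((E i `\` Q i) `&` G j) +
    mu ((Q i `\` E i) `&` G j) / e + e * mu (G j)))).
  rewrite pair_bigA/=; apply: ler_sum => -[i j] _ /=; rewrite pE -/(G j) -mulrBr.
  have m1 : measurable (Q i `&` G j) by exact: measurableI.
  have m2 : measurable ((E i `\` Q i) `&` G j) by apply: measurableI => //; exact: measurableD.
  have m3 : measurable ((Q i `\` E i) `&` G j) by apply: measurableI => //; exact: measurableD.
  have yz : mu (Q i `&` G j) <= mu (G j) by apply: fprob_sub => // s [].
  have y0 := fprob_ge0 m1; have z0 := fprob_ge0 (mG j).
  have q1 := fprob_ge0 m2; have q2 := fprob_ge0 m3.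
  (* [E i] is a union of fibres of [g]. If [G j] meets it, then [G j] lies inside, and z - y is the
     mass of a piece of [E i] outside [Q i]. Otherwise [Q i] meets [G j] only outside [E i], where y
     is small and the bound with e applies. *)
  have [[s [Gs Es]]|nE] := pselect (G j `&` E i !=set0).
    apply: (le_trans (mulr_ln_sub_le y0 z0 _)).
      by move=> y1; exact: lt_le_trans yz.
    rewrite -addrA; apply: ler_wpDr.
      by rewrite addr_ge0// ?divr_ge0// ?mulr_ge0// ltW.
    rewrite lerBlDr -fprobU//; last first.
      by apply/seteqP; split => // x [[[_ h] _] [h' _]].
    apply: fprob_sub => //; first exact: measurableU.
    move=> x Gx; have Ex : E i x by apply: (Eg i s) => //; rewrite Gs Gx.
    by have [Qx|Qx] := pselect (Q i x); [right|left].
  apply: (le_trans (mulr_ln_sub_le_eps e0 y0 yz)); rewrite lerD2r.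
  apply: ler_wpDl => //; apply: ler_wpM2r; first by rewrite invr_ge0 ltW.
  apply: fprob_sub => // x [Qx Gx]; split => //; split => // Ex; apply: nE; by exists x.
apply: ler_sum => i _; rewrite !big_split/= -mulr_suml -mulr_sumr.
have H B : measurable B -> \sum_j mu (B `&` G j) = mu B.
  move=> mB; rewrite -(fprob_splitI hg xpredT mB); congr mu.
  by apply/seteqP; split => // s [].
rewrite !H; [|exact: measurableD..].
by rewrite (fprob_sum1 hg) mulr1.
Qed.

Lemma ent_unit (f : S -> unit) : ent mu f = 0.
Proof.
rewrite /ent (big_pred1 tt); last by case.
have -> : f @^-1` [set tt] = setT by apply/seteqP; split => // s _ /=; case: (f s).
by case: hmu => -> _ _; rewrite ln1 mulr0 oppr0.
Qed.

Lemma ent_pair_le (I J : finType) (f : S -> I) (g : S -> J) (hf : labelling f)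
    (hg : labelling g) : ent mu (fun s => (f s, g s)) <= ent mu f + ent mu g.
Proof.
pose u (s : S) := tt.
have hu : labelling u by apply: labelling1 => i; rewrite (_ : _ @^-1` _ = setT)//;
  apply/seteqP; split => // s _; case: i.
have := ent_strong_subadditive hf hg hu; rewrite ent_unit addr0.
have hfg := labelling_pair hf hg.
rewrite (@ent_eq _ _ (fun s => (f s, g s, u s)) (fun s => (f s, g s)))//; first last.
- by move=> s s'; split => [->//|[-> ->]].
- exact: labelling_pair.
rewrite (@ent_eq _ _ (fun s => (f s, u s)) f)//; first last.
- by move=> s s'; split => [->//|[->]].
- exact: labelling_pair.
rewrite (@ent_eq _ _ (fun s => (g s, u s)) g)//; first last.
- by move=> s s'; split => [->//|[->]].
- exact: labelling_pair.
Qed.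

End fprob_theory.

End finitely_additive.

(** * Itineraries *)

Section fekete.
Context {R : realType} (a : R^nat).
Hypotheses (a0 : a 0%N = 0) (age0 : forall n, 0 <= a n).
Hypothesis sub : forall n p, a (n + p)%N <= a n + a p.

Lemma subadditive_mul q m : a (q * m)%N <= q%:R * a m.
Proof.
elim: q => [|q IH]; first by rewrite mul0n mul0r a0.
by rewrite mulSn (le_trans (sub _ _))// -natr1 mulrDl mul1r addrC lerD2r.
Qed.

(** Fekete's lemma. The lower bound records that the limit is an infimum, which is the source of
    upper semicontinuity of entropy. *)
Lemma fekete : exists h, (fun n => n%:R^-1 * a n) @ \oo --> h /\
  forall m, (0 < m)%N -> h <= m%:R^-1 * a m.
Proof.
pose E := [set m.+1%:R^-1 * a m.+1 | m in [set: nat]].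
have Elb : has_lbound E by exists 0 => _ [m _ <-]; rewrite mulr_ge0 ?invr_ge0.
have hlb m : (0 < m)%N -> inf E <= m%:R^-1 * a m.
  by move=> m0; apply: ge_inf => //; exists m.-1 => //; rewrite prednK.
exists (inf E); split => //; apply/cvgrPdist_le => /= e e0.
have [_ [m _ <-] hm] : exists2 x, E x & x < inf E + e / 2.
  apply: inf_adherent; first by rewrite divr_gt0.
  by split => //; exists (1%:R^-1 * a 1%N); exists 0%N.
set M := m.+1 in hm *.
near=> n.
have n0 : (0 < n)%N by near: n; exists 1%N.
have n0R : 0 < n%:R :> R by rewrite ltr0n.
rewrite ler0_norm ?subr_le0 ?hlb// opprB lerBlDl.
(* Divide n by M: the full blocks give the first term, and the remainder, shorter than M, costs at
   most M * a 1 whatever n is. *)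
have nE : n%:R^-1 * a n <= M%:R^-1 * a M + n%:R^-1 * (M%:R * a 1%N).
  rewrite {2}(divn_eq n M) ler_pdivrMl// mulrDr mulVKf ?gt_eqF//.
  apply: (le_trans (sub _ _)); apply: lerD.
    apply: (le_trans (subadditive_mul _ _)).
    rewrite mulrA ler_wpM2r// ler_pdivlMr ?ltr0n// -natrM ler_nat.
    by rewrite leq_trunc_div.
  have := subadditive_mul (n %% M) 1%N; rewrite muln1 => /le_trans; apply.
  by rewrite ler_wpM2r// ler_nat ltnW// ltn_mod.
apply: (le_trans nE); apply: (@le_trans _ _ (inf E + e / 2 + e / 2)); last by lra.
apply: lerD; first exact: ltW.
rewrite ler_pdivrMl// [leRHS]mulrC -ler_pdivrMl ?divr_gt0//.
near: n; exact: nbhs_infty_ger.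
Unshelve. all: by end_near. Qed.

End fekete.

Section itin_def.
Context {S : Type} (T : S -> S).

(** The fibres of [itin n f] are the cells of the join of the first n preimages of the partition
    given by f, so [ent mu (itin n f)] is the entropy of that join. *)
Definition itin (I : finType) n (f : S -> I) (s : S) : n.-tuple I :=
  [tuple f (iter j T s) | j < n].

Lemma itinP (I : finType) n (f : S -> I) s s' :
  itin n f s = itin n f s' <->
  forall j, (j < n)%N -> f (iter j T s) = f (iter j T s').
Proof.
split=> [e j jn|e].
  have := congr1 (fun t => tnth t (Ordinal jn)) e.
  by rewrite !tnth_mktuple.
by apply: eq_from_tnth => j; rewrite !tnth_mktuple e.
Qed.

Lemma iter_addT a b s : iter (a + b) T s = iter b T (iter a T s).
Proof. by rewrite addnC iterD. Qed.

End itin_def.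

Section itineraries.
Context d {S : measurableType d} {R : realType} (T : S -> S).
Hypothesis mT : forall B, measurable B -> measurable (T @^-1` B).
Implicit Types (mu : set S -> R).
Local Notation itin := (itin T).

Lemma measurable_preimage_iter j B : measurable B -> measurable (iter j T @^-1` B).
Proof.
elim: j B => // j IH B mB.
by have := IH _ (mT mB); congr measurable; apply/seteqP; split => s.
Qed.

Lemma labelling_iter (I : finType) j (f : S -> I) : labelling f ->
  labelling (f \o iter j T).
Proof. by move=> hf B; rewrite comp_preimage; exact: measurable_preimage_iter. Qed.

Lemma labelling_itin (I : finType) n (f : S -> I) : labelling f ->
  labelling (itin n f).
Proof.
move=> hf; apply: labelling1 => u.
have -> : itin n f @^-1` [set u] =
    \bigcap_(j in [set: 'I_n]) (f \o iter j T) @^-1` [set tnth u j].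
  apply/seteqP; split => s /=.
    by move=> <- j _ /=; rewrite tnth_mktuple.
  by move=> h; apply: eq_from_tnth => j; rewrite tnth_mktuple; exact: h.
apply: fin_bigcap_measurable => [|j _]; first exact: finite_finset.
exact: labelling_iter.
Qed.

Lemma ent_itin_le (I : finType) mu (f : S -> I) n m : fprob mu ->
  labelling f -> (n <= m)%N -> ent mu (itin n f) <= ent mu (itin m f).
Proof.
move=> hmu hf nm; apply: ent_le => //; first exact: labelling_itin.
by move=> s s' /itinP e; apply/itinP => j jn; apply: e; exact: leq_trans nm.
Qed.

Lemma ent_itin0 (I : finType) mu (f : S -> I) : fprob mu -> labelling f ->
  ent mu (itin 0 f) = 0.
Proof.
move=> hmu hf; rewrite -(ent_unit hmu (fun=> tt)).
apply: ent_eq => //; first exact: labelling_itin.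
  by apply: labelling1 => -[]; rewrite (_ : _ @^-1` _ = setT)//; apply/seteqP.
by move=> s s'; split => // _; apply/itinP.
Qed.

(** The second block keeps its starting time a, because [mu] is not assumed invariant: this is
    applied to the Gibbs measures before averaging. *)
Lemma ent_itinD (I : finType) mu (f : S -> I) a b : fprob mu -> labelling f ->
  ent mu (itin (a + b) f) <= ent mu (itin a f) + ent mu (itin b f \o iter a T).
Proof.
move=> hmu hf.
have ha : labelling (itin a f) by exact: labelling_itin.
have hb : labelling (itin b f \o iter a T) by apply: labelling_iter; exact: labelling_itin.
apply: le_trans (ent_pair_le hmu ha hb).
apply: ent_le => //; first exact: labelling_pair.
move=> s s' /pair_equal_spec[/itinP e1 /itinP e2]; apply/itinP => j jab.
have [ja|aj] := ltnP j a; first exact: e1.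
by rewrite -(subnKC aj) !iter_addT; apply: e2; rewrite ltn_subLR.
Qed.

Lemma ent_itin_blocks (I : finType) mu (f : S -> I) j q m : fprob mu ->
  labelling f -> ent mu (itin (j + q * m) f) <=
  ent mu (itin j f) + \sum_(r < q) ent mu (itin m f \o iter (r * m + j) T).
Proof.
move=> hmu hf; elim: q => [|q IH]; first by rewrite mul0n addn0 big_ord0 addr0.
rewrite mulSn (addnC m) addnA (le_trans (ent_itinD _ _ hmu hf))//.
by rewrite big_ord_recr/= addrA lerD// addnC.
Qed.

Lemma sum_blocks (g : nat -> R) q m :
  \sum_(j < m) \sum_(r < q) g (r * m + j)%N = \sum_(i < q * m) g i.
Proof.
rewrite exchange_big/=; elim: q => [|q IH]; first by rewrite mul0n !big_ord0.
by rewrite big_ord_recr/= IH mulSn addnC big_split_ord/=.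
Qed.

(* Cut [0, n) into blocks of length m starting at j, and sum over j < m. *)
Lemma ent_itin_windows (I : finType) mu (f : S -> I) n m : fprob mu ->
  labelling f -> m%:R * ent mu (itin n f) <=
  \sum_(i < n) ent mu (itin m f \o iter i T) + (m + m)%:R * #|{: m.-tuple I}|%:R.
Proof.
move=> hmu hf; have [->|m0] := posnP m.
  rewrite mul0r addr_ge0// ?mulr_ge0//; apply: sumr_ge0 => i _.
  by apply: ent_ge0 => //; apply: labelling_iter; exact: labelling_itin.
(* One block more than fits: for every offset j < m the q blocks reach past n, while q * m exceeds n
   by at most m. *)
pose q := (n %/ m).+1; pose B : R := #|{: m.-tuple I}|%:R.
have nq : (n <= q * m)%N by rewrite ltnW// /q ltn_ceil.
have qn : (q * m <= n + m)%N by rewrite /q mulSn addnC leq_add2r leq_trunc_div.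
have E0 i : 0 <= ent mu (itin m f \o iter i T).
  by apply: ent_ge0 => //; apply: labelling_iter; exact: labelling_itin.
have EB i : ent mu (itin m f \o iter i T) <= B.
  by apply: ent_le_card => //; apply: labelling_iter; exact: labelling_itin.
have step (j : 'I_m) : ent mu (itin n f) <=
    B + \sum_(r < q) ent mu (itin m f \o iter (r * m + j) T).
  apply: (@le_trans _ _ (ent mu (itin (j + q * m) f))).
    by apply: ent_itin_le => //; rewrite (leq_trans nq)// leq_addl.
  apply: (le_trans (ent_itin_blocks _ _ _ hmu hf)); rewrite lerD2r.
  apply: (@le_trans _ _ (ent mu (itin m f))); last exact: (EB 0%N).
  by apply: ent_itin_le => //; exact: ltnW.
have : \sum_(j < m) ent mu (itin n f) <=
    \sum_(j < m) (B + \sum_(r < q) ent mu (itin m f \o iter (r * m + j) T)).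
  by apply: ler_sum => j _; exact: step.
rewrite sumr_const card_ord mulr_natl => /le_trans; apply.
rewrite big_split/= (sum_blocks (fun i => ent mu (itin m f \o iter i T))) sumr_const card_ord.
rewrite -[B *+ m]mulr_natl addrC natrD mulrDl addrA.
(* Of the error (m + m) * B, one half has paid for the initial pieces of length j < m; the other
   pays for the at most m windows starting at n or later. *)
rewrite lerD2r -(subnKC nq) big_split_ord/= lerD2l.
apply: (@le_trans _ _ (\sum_(i < q * m - n) B)); first by apply: ler_sum => i _; exact: EB.
by rewrite sumr_const card_ord -[B *+ _]mulr_natl ler_wpM2r// ler_nat leq_subLR.
Qed.

Section invariant.
Context (mu : set S -> R) (hmu : fprob mu).
Hypothesis inv : forall B, measurable B -> mu (T @^-1` B) = mu B.

Lemma invariant_iter j B : measurable B -> mu (iter j T @^-1` B) = mu B.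
Proof.
elim: j B => // j IH B mB; rewrite -[RHS]inv// -[RHS]IH; last exact: mT.
by congr mu; apply/seteqP; split.
Qed.

Lemma ent_iter (I : finType) (f : S -> I) j : labelling f ->
  ent mu (f \o iter j T) = ent mu f.
Proof.
move=> hf; rewrite /ent; congr (- _); apply: eq_bigr => i _.
by rewrite comp_preimage invariant_iter.
Qed.

Lemma ent_itin_subadditive (I : finType) (f : S -> I) a b : labelling f ->
  ent mu (itin (a + b) f) <= ent mu (itin a f) + ent mu (itin b f).
Proof.
move=> hf; apply: (le_trans (ent_itinD _ _ hmu hf)).
by rewrite ent_iter//; exact: labelling_itin.
Qed.

Lemma ent_itin_cvg (I : finType) (f : S -> I) : labelling f ->
  exists h, (fun n => n%:R^-1 * ent mu (itin n f)) @ \oo --> h /\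
  forall m, (0 < m)%N -> h <= m%:R^-1 * ent mu (itin m f).
Proof.
move=> hf; apply: (@fekete _ (fun n => ent mu (itin n f))).
- exact: ent_itin0.
- by move=> n; apply: ent_ge0 => //; exact: labelling_itin.
- by move=> a b; exact: ent_itin_subadditive.
Qed.

(* Chain rule: H(f | g) := ent (f, g) - ent g bounds the entropy gained by f at
   each step. *)
Lemma ent_itin_pair (I J : finType) (f : S -> I) (g : S -> J) n :
  labelling f -> labelling g ->
  ent mu (itin n (fun s => (f s, g s))) <=
  ent mu (itin n g) + n%:R * (ent mu (fun s => (f s, g s)) - ent mu g).
Proof.
move=> hf hg; set c := _ - _; have hfg := labelling_pair hf hg.
elim: n => [|n IH]; first by rewrite !ent_itin0// mul0r addr0.
set F := itin n f; set G := itin n g; set x := f \o iter n T; set y := g \o iter n T.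
have hF : labelling F by exact: labelling_itin.
have hG : labelling G by exact: labelling_itin.
have hx : labelling x by exact: labelling_iter.
have hy : labelling y by exact: labelling_iter.
have hGF := labelling_pair hG hF.
(* Here x and y are the labels at time n. [H1] drops the past from the conditioning of x, leaving
   H(x | y), which is c by invariance ([E5]). [H2] drops F from the conditioning of y, leaving the
   increment of the itinerary entropy of g. *)
have H1 := ent_strong_subadditive hmu hGF hx hy.
have H2 := ent_strong_subadditive hmu hF hy hG.
have E1 : ent mu (itin n.+1 (fun s => (f s, g s))) =
    ent mu (fun s => (G s, F s, x s, y s)).
  apply: ent_eq => //; [exact: labelling_itin|do !apply: labelling_pair => //|].
  move=> s s'; split.
    move=> /pair_equal_spec[/pair_equal_spec[/pair_equal_spec[/itinP eG /itinP eF]]].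
    move=> ex ey; apply/itinP => j; rewrite ltnS leq_eqVlt.
    by move=> /predU1P[->|jn]; [congr pair|rewrite eG// eF].
  move=> /itinP e; congr (_, _, _, _).
  - by apply/itinP => j jn; have [] := e _ (ltnW jn).
  - by apply/itinP => j jn; have [] := e _ (ltnW jn).
  - by have [] := e _ (ltnSn n).
  - by have [] := e _ (ltnSn n).
have E2 : ent mu (fun s => (G s, F s, y s)) = ent mu (fun s => (F s, y s, G s)).
  apply: ent_eq => //; [do !apply: labelling_pair => //..|].
  by move=> s s'; split; do ![move=> /pair_equal_spec[+ ->] | move->].
have E3 : ent mu (itin n.+1 g) = ent mu (fun s => (y s, G s)).
  apply: ent_eq => //; [exact: labelling_itin|do !apply: labelling_pair => //|].
  move=> s s'; split.
    move=> /pair_equal_spec[ey /itinP eG]; apply/itinP => j; rewrite ltnS leq_eqVlt.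
    by move=> /predU1P[->|jn]; [|rewrite eG].
  by move=> /itinP e; congr (_, _); [exact: e|apply/itinP => j jn; apply: e; exact: ltnW].
have E4 : ent mu (itin n (fun s => (f s, g s))) = ent mu (fun s => (F s, G s)).
  apply: ent_eq => //; [exact: labelling_itin|exact: labelling_pair|].
  move=> s s'; split.
    by move=> /pair_equal_spec[/itinP eF /itinP eG]; apply/itinP => j jn; rewrite eF// eG.
  by move=> /itinP e; congr (_, _); apply/itinP => j jn; have [] := e _ jn.
have E5 : ent mu (fun s => (x s, y s)) - ent mu y = c.
  by rewrite /c -(ent_iter n hfg) -(ent_iter n hg).
move: IH; rewrite E1 E3 E4 -natr1 mulrDl mul1r -E5.
move: H1 H2; rewrite E2; set c' := n%:R * c.
rewrite /=; lra.
Qed.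

End invariant.

End itineraries.

(** * Ultralimits of probabilities on a compact space *)

Section regularization.
Context {R : realType} {Z : ptopologicalType}.
Hypotheses (hZ : hausdorff_space Z) (cZ : compact [set: Z]).

Lemma borel_open (O : set Z) : open O -> measurable (O : set (borel Z)).
Proof. by move=> oO; exact: sub_sigma_algebra. Qed.

Lemma borel_closed (K : set Z) : closed K -> measurable (K : set (borel Z)).
Proof.
by move=> cK; rewrite -(setCK K); apply: measurableC; apply: borel_open; exact: closed_openC.
Qed.

Lemma borel_continuous_measurable (Y : ptopologicalType) (G : Z -> Y) : continuous G ->
  forall B : set (borel Y), measurable B -> measurable (G @^-1` B : set (borel Z)).
Proof.
move=> cG B mB; have : measurable_fun setT (G : borel Z -> borel Y).
  apply: (@measurability _ _ (borel Z) (borel Y) setT G (@open Y)) => //.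
  move=> _ [ O oO <-]; rewrite setTI; apply: borel_open.
  by apply: open_comp => // x _; exact: cG.
by move=> /(_ measurableT B mB); rewrite setTI.
Qed.

Context (l : set (borel Z) -> R) (hl : fprob l).

Let lam (O : set Z) := sup [set l K | K in [set K | closed K /\ K `<=` O]].
Let Lam (E : set Z) := inf [set lam O | O in [set O | open O /\ E `<=` O]].

Let l_le_lam (K O : set Z) : closed K -> K `<=` O -> l K <= lam O.
Proof.
move=> cK KO; rewrite /lam; apply: ub_le_sup; last by exists K.
by exists 1 => _ [C [cC _] <-]; apply: (fprob_le1 hl); exact: borel_closed.
Qed.

Let lam_le (O : set Z) c : (forall K, closed K -> K `<=` O -> l K <= c) -> lam O <= c.
Proof.
move=> h; apply: ge_sup; last by move=> _ [K [cK KO] <-]; exact: h.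
by exists (l set0), set0 => //; split => //; exact: closed0.
Qed.

Let lam_ge0 O : 0 <= lam O.
Proof. by rewrite -(fprob0 hl); apply: l_le_lam => //; exact: closed0. Qed.

Let lam_mono (O O' : set Z) : O `<=` O' -> lam O <= lam O'.
Proof.
by move=> OO'; apply: lam_le => K cK KO; apply: l_le_lam => //; exact: subset_trans OO'.
Qed.

Let Lam_le_lam (E O : set Z) : open O -> E `<=` O -> Lam E <= lam O.
Proof.
move=> oO EO; rewrite /Lam; apply: ge_inf; last by exists O.
by exists 0 => _ [V _ <-].
Qed.

Let le_Lam (E : set Z) c : (forall O, open O -> E `<=` O -> c <= lam O) -> c <= Lam E.
Proof.
move=> h; apply: lb_le_inf; last by move=> _ [ O [oO EO] <-]; exact: h.
by exists (lam setT), setT => //; split => //; exact: openT.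
Qed.

Let Lam_adherent (E : set Z) e : 0 < e ->
  exists O, [/\ open O, E `<=` O & lam O <= Lam E + e].
Proof.
move=> e0; have [_ [ O [oO EO] <-] h] : exists2 x,
    [set lam O | O in [set O | open O /\ E `<=` O]] x & x < Lam E + e.
  apply: inf_adherent => //; split; last by exists 0 => _ [V _ <-].
  by exists (lam setT), setT => //; split => //; exact: openT.
by exists O; split => //; exact: ltW.
Qed.

Let Lam_open (O : set Z) : open O -> Lam O = lam O.
Proof.
move=> oO; apply: le_anti; rewrite Lam_le_lam//=.
by apply: le_Lam => V oV; exact: lam_mono.
Qed.

Let Lam_mono (E E' : set Z) : E `<=` E' -> Lam E <= Lam E'.
Proof.
move=> EE'; apply: le_Lam => O oO E'O; apply: Lam_le_lam => //.
exact: subset_trans E'O.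
Qed.

Let Lam_ge0 E : 0 <= Lam E. Proof. by apply: le_Lam => O _ _. Qed.

(* Normality splits a closed subset of a union of two open sets into a closed
   subset of each. *)
Let l_le_sum_lam (O : nat -> set Z) N (K : set Z) : (forall n, open (O n)) -> closed K ->
  K `<=` \bigcup_(n < N) O n -> l K <= \sum_(n < N) lam (O n).
Proof.
move=> oO; elim: N K => [|N IH] K cK KO.
  rewrite big_ord0 (_ : K = set0) ?(fprob0 hl)//.
  by apply/seteqP; split => // x /KO[].
pose W := \bigcup_(n < N) O n.
have oW : open W by apply: bigcup_open => n _.
have cKO : closed (K `\` O N) by rewrite setDE; apply: closedI => //; exact: open_closedC.
have KW : K `\` O N `<=` W.
  move=> x [/KO[n /= nN Onx] ONx]; exists n => //=.
  by move: nN; rewrite ltnS leq_eqVlt => /predU1P[nN|//]; rewrite nN in Onx.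
have nW : set_nbhs (K `\` O N) W by apply/set_nbhsP; exists W; split => // x.
have [V /set_nbhsP[V' [oV' KV' V'V]] VW] := compact_normal hZ cZ cKO nW.
have K1 : closed (K `&` closure V) by apply: closedI => //; exact: closed_closure.
have K2 : closed (K `\` V') by rewrite setDE; apply: closedI => //; exact: open_closedC.
have K3 : K = (K `&` closure V) `|` (K `\` V').
  apply/seteqP; split => x; last by case=> -[].
  move=> Kx; have [V'x|V'x] := pselect (V' x); [left|by right].
  by split => //; apply: subset_closure; exact: V'V.
rewrite [in leLHS]K3; apply: (le_trans (fprob_leU hl (borel_closed K1) (borel_closed K2))).
rewrite big_ord_recr/= lerD//.
  by apply: IH => // x [_ /VW].
apply: l_le_lam => // x [Kx V'x]; apply: contrapT => ONx; apply: V'x; exact: KV'.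
Qed.

(** Compactness supplies the countable subadditivity that [l] lacks: a closed subset of the union of
    the [O n] is covered by finitely many of them. The margins e / 2 ^ (n + 1) add up to at most
    e. *)
Let Lam_sigma_subadditive (E : nat -> set Z) :
  ((Lam (\bigcup_n E n))%:E <= \sum_(n <oo) (Lam (E n))%:E)%E.
Proof.
case E0 : (\sum_(n <oo) (Lam (E n))%:E)%E => [r| |]; last 2 first.
- exact: leey.
- have : (0 <= \sum_(n <oo) (Lam (E n))%:E)%E.
    by apply: nneseries_ge0 => n _ _; rewrite lee_fin.
  by rewrite E0.
rewrite lee_fin; apply/ler_addgt0Pr => e e0.
have /choice[ O hO] (n : nat) : exists O,
    [/\ open O, E n `<=` O & lam O <= Lam (E n) + e / 2 ^+ n.+1].
  by apply: Lam_adherent; rewrite divr_gt0// exprn_gt0.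
have oO : open (\bigcup_n O n) by apply: bigcup_open => n _; case: (hO n).
apply: (@le_trans _ _ (lam (\bigcup_n O n))).
  apply: Lam_le_lam => // x [n _ Ex]; exists n => //.
  by case: (hO n) => _ + _; apply.
apply: lam_le => K cK KO.
have cpK : compact K by apply: (subclosed_compact cK cZ).
have [D' _ KD'] : finite_subset_cover [set: nat] O K.
  by move: cpK; rewrite compact_cover; apply => // n _; case: (hO n).
pose N := (\max_(n <- finmap.enum_fset D') n).+1.
have KN : K `<=` \bigcup_(n < N) O n.
  move=> x /KD'[n /= nD' Onx]; exists n => //=.
  by rewrite /N ltnS; apply: (@leq_bigmax_seq _ _ xpredT id).
apply: (le_trans (@l_le_sum_lam O N K _ cK KN)); first by move=> n; case: (hO n).
apply: (@le_trans _ _ (\sum_(n < N) (Lam (E n) + e / 2 ^+ n.+1))).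
  by apply: ler_sum => n _; case: (hO n).
rewrite big_split/= lerD//.
  rewrite -lee_fin -E0 -sumEFin -(big_mkord xpredT (fun n => (Lam (E n))%:E)).
  by apply: nneseries_lim_ge => n _; rewrite lee_fin.
have -> : \sum_(n < N) e / 2 ^+ n.+1 = e - e / 2 ^+ N.
  elim: N {KN} => [|N IH]; first by rewrite big_ord0 expr0 divr1 subrr.
  by rewrite big_ord_recr/= IH exprS; field; rewrite expf_neq0.
by rewrite lerBlDr lerDl divr_ge0// ?exprn_ge0// ltW.
Qed.

Let Lam0 : Lam set0 = 0.
Proof.
apply: le_anti; rewrite Lam_ge0 andbT (Lam_open open0).
by apply: lam_le => K _; rewrite subset0 => ->; rewrite (fprob0 hl).
Qed.

Let om : set Z -> \bar R := fun E => (Lam E)%:E.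

Let om0 : om set0 = 0%E. Proof. by rewrite /om Lam0. Qed.

Let om_ge0 E : (0 <= om E)%E. Proof. by rewrite lee_fin. Qed.

Let om_mono : {homo om : A B / A `<=` B >-> (A <= B)%E}.
Proof. by move=> A B AB; rewrite lee_fin; exact: Lam_mono. Qed.

Let om_mixin := isOuterMeasure.Build R Z om om0 om_ge0 om_mono Lam_sigma_subadditive.
Let om_outer : {outer_measure set Z -> \bar R} := HB.pack om om_mixin.

(** Choose K closed in the intersection of V and O, then K' closed in [V \ K], an open set
    containing [V \ O]. These are disjoint closed subsets of V, so finite additivity of [l]
    suffices. *)
Let lam_split (V O : set Z) : open V -> open O ->
  lam (V `&` O) + Lam (V `\` O) <= lam V.
Proof.
move=> oV oO; rewrite -lerBrDr; apply: lam_le => K cK KVO.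
rewrite lerBrDr -lerBrDl.
apply: (@le_trans _ _ (lam (V `\` K))).
  apply: Lam_le_lam; first by rewrite setDE; apply: openI => //; exact: closed_openC.
  by move=> x [Vx Ox]; split => // /KVO[].
apply: lam_le => K' cK' K'V; rewrite lerBrDl.
rewrite -(fprobU hl); [|exact: borel_closed|exact: borel_closed|].
- apply: l_le_lam; first exact: closedU.
  by move=> x [/KVO[]|/K'V[]].
- by apply/seteqP; split => // x [Kx /K'V[]].
Qed.

Let open_caratheodory (O : set Z) : open O -> caratheodory_measurable om O.
Proof.
move=> oO; apply: (@le_caratheodory_measurable _ _ om_outer) => X.
rewrite /om_outer /= /om -EFinD lee_fin; apply: le_Lam => V oV XV.
apply: le_trans (lam_split oV oO); rewrite -(Lam_open (openI oV oO)); apply: lerD.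
  by apply: Lam_mono; exact: setSI.
by apply: Lam_mono; exact: setSI.
Qed.

Let borel_caratheodory (B : set (borel Z)) : measurable B -> caratheodory_measurable om B.
Proof.
apply: smallest_sub => [|O oO]; last exact: open_caratheodory.
split.
- exact: (caratheodory_measurable_set0 om_outer).
- by move=> A mA; rewrite setTD; exact: (caratheodory_measurable_setC (mu := om_outer)).
- by move=> A mA; exact: (caratheodory_measurable_bigcup (mu := om_outer)).
Qed.

Let omb : set (borel Z) -> \bar R := om.

Let om_sigma_additive : semi_sigma_additive omb.
Proof.
move=> A mA tA mUA.
apply: (@caratheodory_measure_sigma_additive _ _ om_outer A _ tA).
  by move=> n; exact: borel_caratheodory (mA n).
exact: borel_caratheodory mUA.
Qed.

Let omT : omb setT = 1%E.
Proof.
rewrite /omb /om (Lam_open openT); congr EFin; apply: le_anti; apply/andP; split.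
  by apply: lam_le => K cK _; apply: (fprob_le1 hl); exact: borel_closed.
by case: (hl) => <- _ _; apply: l_le_lam => //; exact: closedT.
Qed.

Let om_measure := isMeasure.Build _ _ _ omb om0 om_ge0 om_sigma_additive.
Let om_meas : {measure set (borel Z) -> \bar R} := HB.pack omb om_measure.
Let om_prob := Measure_isProbability.Build _ _ _ om_meas omT.
Let nu : probability (borel Z) R := HB.pack omb om_measure om_prob.

(** For invariance, G need not be injective: a closed K inside the preimage of O satisfies l K <= l
    (G^-1 (G K)) = l (G K), and G K is again closed by compactness. This gives one inequality for
    every set; applied to complements of Borel sets it gives the other. *)
Lemma regularization : exists nu : probability (borel Z) R,
  (forall O : set Z, open O -> fine (nu O) <= l O) /\
  forall G : Z -> Z, continuous G ->
    (forall B : set (borel Z), measurable B -> l (G @^-1` B) = l B) ->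
    forall B : set (borel Z), measurable B -> nu (G @^-1` B) = nu B.
Proof.
exists nu; split=> [ O oO|G cG linv].
  rewrite /nu /= /omb /om /= Lam_open//; apply: lam_le => K cK KO.
  by apply: (fprob_sub hl) => //; [exact: borel_closed|exact: borel_open].
have le B : Lam (G @^-1` B) <= Lam B.
  apply: le_Lam => O oO BO; apply: (@le_trans _ _ (lam (G @^-1` O))).
    apply: Lam_le_lam; last by move=> x /BO.
    by apply: open_comp => // x _; exact: cG.
  apply: lam_le => K cK KO.
  have cGK : closed (G @` K).
    apply: compact_closed => //; apply: continuous_compact.
      exact: continuous_subspaceT.
    exact: (subclosed_compact cK cZ).
  apply: (@le_trans _ _ (l (G @` K))); last first.
    by apply: l_le_lam => // _ [x Kx <-]; exact: KO.
  have mGK := borel_closed cGK.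
  rewrite -(linv _ mGK); apply: (fprob_sub hl (borel_closed cK)).
    exact: borel_continuous_measurable mGK.
  by move=> x Kx; exists x.
move=> B mB; have mGB := borel_continuous_measurable cG mB.
have := le (~` B); rewrite preimage_setC.
have E (C : set (borel Z)) : measurable C -> Lam (~` C) = 1 - Lam C.
  move=> mC; have := probability_setC nu mC; rewrite /nu /= /omb /om.
  by rewrite -EFinB => -[].
rewrite !E// lerD2l lerN2 => h; rewrite /nu/= /omb /om; congr EFin.
by apply: le_anti; rewrite h le.
Qed.

End regularization.

Lemma borel_continuous_measurable_fun (R : realType) (Z : ptopologicalType)
  (f : Z -> R) : continuous f -> measurable_fun setT (f : borel Z -> R).
Proof.
move=> cf; apply: (measurability _ (RGenOpens.measurableE R)).
move=> _ [_ [a [b ->] <-]].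
rewrite setTI; apply: borel_open; apply: open_comp => // x _; exact: cf.
Qed.

Section ultra.
Context {R : realType} {I : Type} (U : set_system I) {UU : UltraFilter U}.

(** Compactness of [a, b] yields a cluster point, and an ultrafilter converges to each of its
    cluster points. *)
Lemma ultra_bounded_cvg (f : I -> R) (a b : R) : (forall i, a <= f i <= b) ->
  cvg (f @ U).
Proof.
move=> h; have : (f @ U) `[a, b]%classic by apply: nearW => i /=; rewrite in_itv/=.
move=> /(@segment_compact R a b (f @ U) _)[p [_ cp]].
apply/cvg_ex; exists p => V nV.
have [//|fV] := in_ultra_setVsetC (f @^-1` V) UU.
by have [x []] := cp (~` V) V fV nV.
Qed.

End ultra.

(** * Integration against finitely additive set functions *)

Section staircase.
Context {R : realType}.

(* The number of k < K with k + 1 <= x is [x] rounded down, as soon as x <= K. *)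
Definition stairs (K : nat) (x : R) : R := \sum_(k < K) (k.+1%:R <= x)%R%:R.

Lemma stairs_le K x : 0 <= x -> stairs K x <= x.
Proof.
move=> x0; rewrite /stairs; elim: K => [|K IH]; first by rewrite big_ord0.
rewrite big_ord_recr/=; case: (leP K.+1%:R x) => [h|_] /=; last by rewrite addr0.
apply: le_trans h; rewrite -[K.+1%:R]natr1 lerD//.
apply: (@le_trans _ _ (\sum_(k < K) 1)); last by rewrite sumr_const card_ord.
by apply: ler_sum => k _; case: (k.+1%:R <= x)%R => /=; rewrite ?ler01.
Qed.

Lemma le_stairs K x : x <= K%:R -> x <= stairs K x + 1.
Proof.
(* Truncating x makes the claim inductive in K, as the bound x <= K is lost when K decreases. *)
move=> xK; suff : Order.min x K.+1%:R <= stairs K x + 1.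
  by rewrite min_l// (le_trans xK)// ler_nat.
rewrite /stairs; elim: K {xK} => [|K IH].
  by rewrite big_ord0 add0r ge_min lexx orbT.
rewrite big_ord_recr/=; case: (leP K.+1%:R x) => [h|h] /=.
  rewrite (@le_trans _ _ K.+2%:R) ?ge_min ?lexx ?orbT//.
  by move: IH; rewrite min_r// -[K.+2%:R]natr1; lra.
rewrite addr0; apply: le_trans IH; rewrite ge_min.
by rewrite le_min lexx (ltW h).
Qed.

End staircase.

Section staircase_integral.
Context {R : realType} {Z : Type}.
Implicit Types (phi : Z -> R) (mu : set Z -> R).

(* A Riemann sum approximating, to within 1 / N, the integral with respect to mu
   of a function bounded by C; it makes sense when mu is only finitely additive. *)
Definition stairs_integral phi C N K mu : R :=
  - C + N%:R^-1 * \sum_(k < K) mu [set z | k.+1%:R <= N%:R * (phi z + C)].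

(** The shift by C places N (phi z + C) in [0, 2 C N], where K steps resolve it to within 1;
    dividing by N leaves the error 1 / N. *)
Lemma stairs_bounds phi C N K z : `|phi z| <= C -> (0 < N)%N ->
  2 * C * N%:R <= K%:R ->
  - C + N%:R^-1 * stairs K (N%:R * (phi z + C)) <= phi z <=
  - C + N%:R^-1 * stairs K (N%:R * (phi z + C)) + N%:R^-1.
Proof.
move=> hC N0 hK; have N0R : 0 < N%:R :> R by rewrite ltr0n.
have /andP[h1 h2] : - C <= phi z <= C by rewrite -ler_norml.
apply/andP; split.
  rewrite -lerBrDl ler_pdivrMl// addrC [_ - _]addrC opprK addrC.
  by apply: stairs_le; rewrite mulr_ge0//; lra.
rewrite -addrA -lerBlDl -[leRHS]/(_ + _) -{2}(mulr1 N%:R^-1) -mulrDr.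
rewrite ler_pdivlMl// opprK; apply: le_stairs.
by apply: le_trans hK; rewrite mulrC ler_wpM2r// ; lra.
Qed.

End staircase_integral.

Section staircase_probability.
Context d {Z : measurableType d} {R : realType} (nu : probability Z R).
Variables (phi : Z -> R) (C : R).
Hypotheses (mphi : measurable_fun setT phi) (phiC : forall z, `|phi z| <= C).

Lemma fprob_probability : fprob (fine \o nu).
Proof.
split => /=; first by rewrite probability_setT.
  by move=> B mB; exact: fine_ge0.
move=> B D mB mD BD; rewrite measureU// fineD//; exact: fin_num_measure.
Qed.

Lemma measurable_level N k :
  measurable [set z | k.+1%:R <= N%:R * (phi z + C)].
Proof.
have m : measurable_fun setT (fun z => N%:R * (phi z + C)).
  by apply: measurable_funM => //; apply: measurable_funD.
have := m measurableT `[k.+1%:R, +oo[%classic (measurable_itv _); rewrite setTI.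
by congr measurable; apply/seteqP; split => z /=; rewrite in_itv/= andbT.
Qed.

Lemma level_indic N k z : (k.+1%:R <= N%:R * (phi z + C))%R%:R =
  \1_[set z | k.+1%:R <= N%:R * (phi z + C)] z :> R.
Proof. by rewrite indicE; congr (nat_of_bool _)%:R; apply/idP/idP; rewrite inE. Qed.

Lemma integrable_bounded (f : Z -> R) M : measurable_fun setT f ->
  (forall z, `|f z| <= M) -> nu.-integrable setT (EFin \o f).
Proof.
move=> mf fM; apply: measurable_bounded_integrable => //.
  apply: (le_lt_trans _ (ltry 1)); rewrite le_eqVlt; apply/orP; left; apply/eqP.
  exact: probability_setT.
exists M; split; first exact: num_real.
by move=> x Mx z _ /=; exact: le_trans (fM z) (ltW Mx).
Qed.

Lemma integral_fine : (\int[nu]_z (phi z)%:E)%E = (fine (\int[nu]_z (phi z)%:E)%E)%:E.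
Proof.
rewrite fineK//; apply: integrable_fin_num => //.
exact: (integrable_bounded mphi phiC).
Qed.

(** The constant a is left free so that both the lower staircase and the one raised by 1 / N are
    covered. *)
Lemma integral_stairs (a b : R) N K :
  (\int[nu]_z (a + b * stairs K (N%:R * (phi z + C)))%:E)%E =
  (a + b * \sum_(k < K) fine (nu [set z | k.+1%:R <= N%:R * (phi z + C)]))%:E.
Proof.
pose E k := [set z | k.+1%:R <= N%:R * (phi z + C)].
have mE k : measurable (E k) by exact: measurable_level.
have -> : (\int[nu]_z (a + b * stairs K (N%:R * (phi z + C)))%:E =
   \int[nu]_z (cst a%:E z + b%:E * \sum_(k < K) (\1_(E k) z)%:E))%E.
  apply: eq_integral => z _; rewrite sumEFin/= -EFinM -EFinD; congr (_ + _ * _)%:E.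
  by apply: eq_bigr => k _; exact: level_indic.
have iE : nu.-integrable setT (fun z => (\sum_(k < K) (\1_(E k) z)%:E)%E).
  by apply: integrable_sum => // k _; exact: integrable_indic.
rewrite integralD//; last 2 first.
- exact: finite_measure_integrable_cst.
- exact: integrableZl.
rewrite integral_cst// [X in (_ * X + _)%E](_ : _ = 1%E); last exact: probability_setT.
rewrite mule1 integralZl// integral_sum//; last first.
  by move=> k; exact: integrable_indic.
rewrite EFinD EFinM -sumEFin; congr (_ + _ * _)%E; apply: eq_bigr => k _.
by rewrite integral_indic// setIT fineK//; apply: fin_num_measure; exact: mE.
Qed.

Lemma stairs_integral_bounds N K : (0 < N)%N -> 2 * C * N%:R <= K%:R ->
  stairs_integral phi C N K (fine \o nu) <= fine (\int[nu]_z (phi z)%:E)%E <=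
  stairs_integral phi C N K (fine \o nu) + N%:R^-1.
Proof.
move=> N0 hK.
have is_ a b : nu.-integrable setT (EFin \o (fun z => a + b * stairs K (N%:R * (phi z + C)))).
  apply: (@integrable_bounded _ (`|a| + `|b| * K%:R)).
    apply: measurable_funD => //; apply: measurable_funM => //.
    apply: measurable_sum => k.
    have -> : (fun z => (k.+1%:R <= N%:R * (phi z + C))%R%:R : R) =
        \1_[set z | k.+1%:R <= N%:R * (phi z + C)].
      by apply/funext => z; exact: level_indic.
    exact: measurable_indic (measurable_level N k).
  move=> z; rewrite (le_trans (ler_normD _ _))// lerD2l normrM ler_wpM2l//.
  rewrite ger0_norm; last by apply: sumr_ge0 => k _; exact: ler0n.
  apply: (@le_trans _ _ (\sum_(k < K) 1)); last by rewrite sumr_const card_ord.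
  by apply: ler_sum => k _; case: (k.+1%:R <= _)%R => /=; rewrite ?ler01.
apply/andP; split; rewrite -lee_fin -integral_fine.
  rewrite /stairs_integral -(@integral_stairs (- C) N%:R^-1 N K).
  apply: le_integral => //; first exact: is_.
    exact: (integrable_bounded mphi phiC).
  by move=> z _; rewrite lee_fin; have /andP[] := stairs_bounds (phiC z) N0 hK.
rewrite /stairs_integral addrAC -(@integral_stairs (- C + N%:R^-1) N%:R^-1 N K).
apply: le_integral => //; first exact: (integrable_bounded mphi phiC).
  exact: is_.
move=> z _; rewrite lee_fin; have /andP[_] := stairs_bounds (phiC z) N0 hK.
by rewrite addrAC.
Qed.

End staircase_probability.

(** * Limit measures and upper semicontinuity *)

Section limit_measure.
Context {R : realType} {Z : ptopologicalType} {I : Type} (U : set_system I)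
  {UU : UltraFilter U} (mu_ : I -> set (borel Z) -> R).
Hypotheses (hZ : hausdorff_space Z) (cZ : compact [set: Z])
  (hmu : forall i, fprob (mu_ i)).

(** Asymptotic invariance makes the setwise limit [l] exactly invariant, and regularization keeps
    this. The second conclusion is the closed-set half of the portmanteau theorem: regularization
    does not raise open sets, hence does not lower closed ones. *)
Lemma limit_measure (G : Z -> Z) : continuous G ->
  (forall B : set (borel Z), measurable B ->
    (fun i => mu_ i (G @^-1` B) - mu_ i B) @ U --> (0 : R)) ->
  exists nu : probability (borel Z) R,
    (forall B : set (borel Z), measurable B -> nu (G @^-1` B) = nu B) /\
    (forall C : set Z, closed C -> forall e, 0 < e ->
      \forall i \near U, mu_ i C <= fine (nu C) + e).
Proof.
move=> cG inv; pose l (B : set (borel Z)) : R := lim (mu_ ^~ B @ U).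
have cl (B : set (borel Z)) : measurable B -> mu_ ^~ B @ U --> l B.
  move=> mB; apply: (@ultra_bounded_cvg _ _ _ UU _ 0 1) => i.
  by rewrite (fprob_ge0 (hmu i) mB) (fprob_le1 (hmu i) mB).
have hl : fprob l.
  split.
  - apply/cvg_lim => //; rewrite (_ : mu_ ^~ _ = cst 1); first exact: cvg_cst.
    by apply/funext => i; case: (hmu i).
  - move=> B mB; apply: limr_ge; first by apply/cvg_ex; exists (l B); exact: cl.
    apply: nearW => i.
    exact: (fprob_ge0 (hmu i) mB).
  - move=> B D mB mD BD; apply/cvg_lim => //.
    rewrite (_ : mu_ ^~ _ = mu_ ^~ B \+ mu_ ^~ D).
      by apply: cvgD; exact: cl.
    by apply/funext => i; rewrite (fprobU (hmu i)).
have [nu [nuO nuG]] := regularization hZ cZ hl.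
exists nu; split.
  apply: nuG => // B mB; have mGB := borel_continuous_measurable cG mB.
  apply/eqP; rewrite -subr_eq0; apply/eqP.
  by apply: cvg_unique (inv B mB); [exact: Rhausdorff|apply: cvgB; exact: cl].
move=> C cC e e0.
have lC : l C <= fine (nu C).
  have mC := borel_closed cC.
  have := nuO (~` C) (closed_openC cC).
  rewrite (fprobC hl mC) (probability_setC nu mC) fineB//; last exact: fin_num_measure.
  by rewrite lerD2l lerN2.
have /cvgrPdist_le/(_ e e0) := cl C (borel_closed cC).
apply: filterS => i; rewrite ler_norml => /andP[h _]; lra.
Qed.

Context (nu : probability (borel Z) R).
Hypothesis nuC : forall C : set Z, closed C -> forall e, 0 < e ->
  \forall i \near U, mu_ i C <= fine (nu C) + e.

(** The closed-set bound applies to C and to its complement. *)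
Lemma clopen_cvg (C : set Z) : closed C -> open C ->
  mu_ ^~ C @ U --> fine (nu C).
Proof.
move=> cC oC; apply/cvgrPdist_le => e e0.
have mC := borel_closed cC.
have := nuC (open_closedC oC) e0; have := nuC cC e0.
apply: filterS2 => i h1; rewrite (fprobC (hmu i) mC) (probability_setC nu mC).
rewrite fineB//; last exact: fin_num_measure.
move=> h2; rewrite ler_norml; apply/andP; split; move: h2; rewrite /=; lra.
Qed.

(** Superlevel sets of a continuous function are closed, so the closed-set bound applies to each
    term of the staircase sum. Half of e is spent on the mesh 1 / N, half on the K terms. The
    numbers [e_ i] stand for integrals against [mu_ i], which need not be measures. *)
Lemma stairs_usc (phi : Z -> R) (C : R) (e_ : I -> R) : continuous phi ->
  (forall z, `|phi z| <= C) ->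
  (forall N K, (0 < N)%N -> 2 * C * N%:R <= K%:R -> forall i,
    e_ i <= stairs_integral phi C N K (mu_ i) + N%:R^-1) ->
  forall e, 0 < e -> \forall i \near U, e_ i <= fine (\int[nu]_z (phi z)%:E)%E + e.
Proof.
move=> cphi phiC hE e e0.
have mphi := borel_continuous_measurable_fun cphi.
pose N := (Num.truncn (2 / e)).+1; pose K := (Num.truncn (2 * C * N%:R)).+1.
have N0 : 0 < N%:R :> R by rewrite ltr0n.
have N0n : (0 < N)%N by [].
have hK : 2 * C * N%:R <= K%:R.
  by rewrite ltW// truncnS_gt.
have hN : N%:R^-1 <= e / 2.
  rewrite invf_ple ?posrE ?divr_gt0// invf_div ltW//.
  by rewrite truncnS_gt.
pose E k := [set z | k.+1%:R <= N%:R * (phi z + C)].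
have cE k : closed (E k).
  have -> : E k = (fun z => N%:R * (phi z + C)) @^-1` [set x | k.+1%:R <= x] by [].
  apply: closed_comp; last exact: closed_ge.
  move=> z _.
  by apply: cvgM; [exact: cvg_cst|apply: cvgD; [exact: cphi|exact: cvg_cst]].
have H k d : 0 < d -> \forall i \near U,
    \sum_(j < k) mu_ i (E j) <= \sum_(j < k) fine (nu (E j)) + d.
  elim: k d => [|k IH] d d0; first by apply: nearW => i; rewrite !big_ord0 add0r ltW.
  have d2 : 0 < d / 2 by rewrite divr_gt0.
  have := nuC (cE k) d2; have := IH _ d2.
  by apply: filterS2 => i h1 h2; rewrite !big_ord_recr/=; lra.
have d0 : 0 < N%:R * (e / 2) by rewrite mulr_gt0// divr_gt0.
have := H K _ d0; apply: filterS => i hi.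
apply: (le_trans (hE N K N0n hK i)).
have /andP[h _] := stairs_integral_bounds nu mphi phiC N0n hK.
rewrite (splitr e) addrA; apply: lerD => //.
apply: le_trans (_ : stairs_integral phi C N K (fine \o nu) + e / 2 <= _); last by rewrite lerD2r.
rewrite /stairs_integral -addrA lerD2l -ler_pdivlMl ?invr_gt0// invrK mulrDr.
by rewrite mulVKf ?gt_eqF.
Qed.

Lemma ent_usc (J : finType) (f : Z -> J) : (forall j, open (f @^-1` [set j])) ->
  forall e, 0 < e -> \forall i \near U,
    @ent _ (borel Z) _ (mu_ i) J f <= @ent _ (borel Z) _ (fine \o nu) J f + e.
Proof.
move=> of_ e e0.
have cf j : closed (f @^-1` [set j]).
  rewrite -[X in closed X]setCK; apply: open_closedC.
  have -> : ~` (f @^-1` [set j]) = \bigcup_(k in [set k | k != j]) f @^-1` [set k].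
    apply/seteqP; split => z /=; first by move=> h; exists (f z) => //; exact/eqP.
    by move=> [k /= /eqP kj fk] fj; apply: kj; rewrite -fk -fj.
  by apply: bigcup_open => k _.
have H j d : 0 < d -> \forall i \near U,
    - (mu_ i (f @^-1` [set j]) * ln (mu_ i (f @^-1` [set j]))) <=
    - (fine (nu (f @^-1` [set j])) * ln (fine (nu (f @^-1` [set j])))) + d.
  move=> d0; set y0 := fine _; set B := f @^-1` _.
  have mB : measurable (B : set (borel Z)) := borel_open (of_ j).
  have cB : mu_ ^~ B @ U --> y0 by apply: clopen_cvg; [exact: cf|exact: of_].
  have b i : 0 <= mu_ i B <= 1.
    by rewrite (fprob_ge0 (hmu i) mB) (fprob_le1 (hmu i) mB).
  have : 0 <= y0 by rewrite fine_ge0.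
  (* Write x for [mu_ i B]. If the limit mass y0 is 0, then x <= (d / 2)^2 makes x / (d / 2) + d / 2
     at most d. If y0 > 0, the tangent bound gives - x ln x <= y0 - x - x ln y0, whose limit is - y0
     ln y0. *)
  rewrite le_eqVlt => /predU1P[y00|y00].
    have d2 : 0 < d / 2 by rewrite divr_gt0.
    have dd : 0 < (d / 2) * (d / 2) by rewrite mulr_gt0.
    have /cvgrPdist_le/(_ _ dd) := cB; apply: filterS => i.
    have /andP[b0 b1] := b i.
    rewrite -y00 sub0r normrN ger0_norm// mul0r oppr0 add0r => h.
    have := mulr_ln_sub_le_eps d2 b0 b1; rewrite ln1 sub0r mulrN mulr1.
    move=> /le_trans; apply; rewrite [leRHS](splitr d) lerD2r.
    by rewrite ler_pdivrMr.
  have c0 : (fun i => y0 - mu_ i B - mu_ i B * ln y0) @ U --> y0 - y0 - y0 * ln y0.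
    apply: cvgB; first by apply: cvgB => //; exact: cvg_cst.
    by apply: cvgM => //; exact: cvg_cst.
  have /cvgrPdist_le/(_ _ d0) := c0; apply: filterS => i.
  rewrite ler_norml => /andP[h _].
  have /andP[b0 b1] := b i.
  have := @mulr_ln_sub_le _ (mu_ i B) y0 b0 (ltW y00) (fun=> y00).
  rewrite mulrBr; lra.
have e1 : 0 < e / #|J|.+1%:R by rewrite divr_gt0.
have : \forall i \near U, forall j,
    - (mu_ i (f @^-1` [set j]) * ln (mu_ i (f @^-1` [set j]))) <=
    - (fine (nu (f @^-1` [set j])) * ln (fine (nu (f @^-1` [set j])))) + e / #|J|.+1%:R.
  by apply: filter_forall => j; exact: H.
apply: filterS => i hi; rewrite /ent -!sumrN.
apply: (@le_trans _ _ (\sum_j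
    (- (fine (nu (f @^-1` [set j])) * ln (fine (nu (f @^-1` [set j])))) +
     e / #|J|.+1%:R))).
  exact: ler_sum.
rewrite big_split/= lerD2l sumr_const -[_ *+ _]mulr_natr -mulrA ler_piMr// ?ltW//.
by rewrite ltr_pdivrMl// mulr1 ltr_nat.
Qed.

End limit_measure.

(** * The topology of the shift and of the skew product *)

Section shift_topology.
Context {R : realType} {A : finType} {M : transition A}.
Local Notation Sigma := (markov_shift R M).
Local Notation T := (@left_shift R A M).

Definition agree N (w w' : Sigma) := forall n, (n <= N)%N -> ~~ differ_at w w' n.

Lemma agreeP N w w' : agree N w w' <->
  forall n, (n <= N)%N -> w n%:Z = w' n%:Z /\ w (- n%:Z) = w' (- n%:Z).
Proof.
split=> h n nN; last first.
  by have [e1 e2] := h n nN; rewrite /differ_at e1 e2 !eqxx.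
by have := h n nN; rewrite /differ_at negb_or !negbK => /andP[/eqP -> /eqP ->].
Qed.

Lemma agree_coord N w w' (i : int) : agree N w w' -> (`|i| <= N)%N -> w i = w' i.
Proof.
move=> /agreeP h; case: i => n nN; first by have [] := h _ nN.
by have [_] := h _ nN; rewrite -NegzE.
Qed.

Lemma agree_sym N w w' : agree N w w' -> agree N w' w.
Proof. by move=> /agreeP h; apply/agreeP => n /h[-> ->]. Qed.

Lemma agree_trans N w w' w'' : agree N w w' -> agree N w' w'' -> agree N w w''.
Proof.
move=> /agreeP h /agreeP h'; apply/agreeP => n nN.
by have [-> ->] := h n nN; exact: h'.
Qed.

Lemma agree_le N N' w w' : (N <= N')%N -> agree N' w w' -> agree N w w'.
Proof. by move=> NN' h n nN; apply: h; exact: leq_trans NN'. Qed.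

Lemma mdist_agree N w w' : (mdist w w' < 2 ^- N) <-> agree N w w'.
Proof.
rewrite [mdist w w']/(shift_mdist w w') /shift_mdist; case: pselect => [e|ne]; last first.
  split=> [_ n _|_]; last by rewrite invr_gt0 exprn_gt0.
  by apply/negP => dn; apply: ne; exists n.
case: ex_minnP => k dk kmin.
rewrite ltf_pV2 ?posrE ?exprn_gt0// ltr_eXn2l ?ltr1n//.
split=> [Nk n nN|h]; last by rewrite ltnNge; apply/negP => /h; rewrite dk.
by apply/negP => /kmin; rewrite leqNgt (leq_ltn_trans nN).
Qed.

Lemma exists_exprN_lt (e : R) : 0 < e -> exists N, 2 ^- N < e.
Proof.
move=> e0; exists (Num.truncn e^-1).+1.
rewrite invf_plt ?posrE ?exprn_gt0//; apply: (lt_trans (truncnS_gt _)).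
by rewrite -natrX ltr_nat ltn_expl.
Qed.

Lemma nbhs_agree (w : Sigma) (B : set Sigma) :
  nbhs w B <-> exists N, [set w' | agree N w w'] `<=` B.
Proof.
split=> [/nbhs_ballP[e /= e0 h]|[N h]].
  have [N Ne] := exists_exprN_lt e0; exists N => w' /mdist_agree ww'; apply: h.
  by rewrite ballEmdist/=; exact: lt_trans Ne.
apply/nbhs_ballP; exists (2 ^- N) => /=; first by rewrite invr_gt0 exprn_gt0.
by move=> w'; rewrite ballEmdist/= => /mdist_agree; exact: h.
Qed.

(** Sets determined by the coordinates in [-N, N], that is, finite unions of two-sided cylinders. *)
Definition window_set N (B : set Sigma) := forall w w', agree N w w' -> B w -> B w'.

Lemma window_set_open N B : window_set N B -> open B.
Proof.
move=> h; rewrite openE => w Bw; apply/nbhs_agree; exists N => w' ww'; exact: h ww' Bw.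
Qed.

Lemma window_set_closed N B : window_set N B -> closed B.
Proof.
move=> h; rewrite -[B]setCK; apply: open_closedC; apply: (@window_set_open N).
by move=> w w' /agree_sym ww' Bw Bw'; apply: Bw; exact: h ww' Bw'.
Qed.

(** The alphabet being finite, an ultrafilter selects one letter [c i] at each coordinate. The
    sequence c obeys the transition rule because the events at i and i + 1 hold at a common
    point. *)
Lemma shift_compact : compact [set: Sigma].
Proof.
rewrite compact_ultra => F FU _.
have /choice[c hc] (i : int) : exists a, F [set w : Sigma | w i = a].
  apply: contrapT => /forallNP h.
  have : \forall w \near F, forall a : A, (w : Sigma) i <> a.
    apply: filter_forall => a; have [/h//|] := in_ultra_setVsetC [set w : Sigma | w i = a] FU.
    exact.
  by move=> /filter_ex[w /(_ (w i))].
have cM i : M (c i) (c (i + 1)).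
  have /filter_ex[w [<- <-]] :
      F ([set w : Sigma | w i = c i] `&` [set w : Sigma | w (i + 1) = c (i + 1)]).
    exact: filterI.
  exact: coordsP.
exists (MarkovShift R cM); split => // B /nbhs_agree[N hN].
apply: filterS (hN) _.
elim: N {hN} => [|N IH].
  apply: filterS (hc 0) => w /= w0; apply/agreeP => n.
  by rewrite leqn0 => /eqP ->; rewrite oppr0 w0.
apply: filterS (filterI IH (filterI (hc N.+1%:Z) (hc (- N.+1%:Z)))).
move=> w /= [/agreeP h [h1 h2]]; apply/agreeP => n.
by rewrite leq_eqVlt => /predU1P[->|]; [rewrite h1 h2|exact: h].
Qed.

Lemma iter_shift j (w : Sigma) i : iter j T w i = w (i + j%:Z).
Proof.
elim: j w i => [|j IH] w i; first by rewrite addr0.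
by rewrite iterS /= IH; congr (coords _); lia.
Qed.

Definition letter (w : Sigma) : A := w 0.

Lemma cylinderE n (u : n.-tuple A) : cylinder u = itin T n letter @^-1` [set u].
Proof.
apply/seteqP; split => w /=.
  move=> h; apply: eq_from_tnth => j; rewrite tnth_mktuple /letter iter_shift add0r.
  exact: h.
by move=> <- j; rewrite tnth_mktuple /letter iter_shift add0r.
Qed.

Lemma window_set_itin n (B : set (n.-tuple A)) : window_set n (itin T n letter @^-1` B).
Proof.
move=> w w' /agreeP h /=; suff -> : itin T n letter w = itin T n letter w' by [].
apply/itinP => j jn; rewrite /letter !iter_shift !add0r.
by have [] := h j (ltnW jn).
Qed.

Lemma left_shift_continuous : continuous T.
Proof.
move=> w B /nbhs_agree[N hN]; apply/nbhs_agree; exists N.+1 => w' /agreeP h.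
apply: hN; apply/agreeP => n nN /=; split.
  by have [] := h n.+1 nN; rewrite -addn1 PoszD.
case: n nN => [|n] nN; first by have [] := h 1%N isT; rewrite oppr0 add0r.
have -> : - n.+1%:Z + 1 = - n%:Z by lia.
by have [] := h n (leqW (ltnW nN)).
Qed.

End shift_topology.

(** * Continuity and compactness of the skew product *)

Section skew_topology.
Context {R : realType} {A : finType} {M : transition A} {X : pmetricType R}.
Local Notation Sigma := (markov_shift R M).

(** Makes the supremum in [sup_mdist] that of a bounded set, so that it does dominate each pointwise
    distance. *)
Lemma compact_mdist_bounded (cX : compact [set: X]) :
  exists B : R, forall x y : X, mdist x y <= B.
Proof.
have : cover_compact [set: X] by rewrite -compact_cover.
move=> /(_ nat setT (fun n => (ball (point : X) n.+1%:R)°))[].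
- by move=> n _; exact: open_interior.
- move=> x _; exists (Num.truncn (mdist point x + 1)) => //.
  apply/nbhs_ballP; exists 1 => //= y; rewrite !ballEmdist/= => xy.
  apply: (le_lt_trans (metric_triangle _ x _)); apply: lt_trans (truncnS_gt _).
  by rewrite ltrD2l.
move=> D _ hD; pose N := (\max_(n <- finmap.enum_fset D) n).+1.
have h (x : X) : mdist point x <= N%:R.
  have [n /= nD /interior_subset] := hD x I; rewrite ballEmdist/= => /ltW /le_trans; apply.
  by rewrite ler_nat ltnS; apply: (@leq_bigmax_seq _ _ xpredT id).
exists (N%:R + N%:R) => x y; apply: (le_trans (metric_triangle x point y)).
by rewrite (metric_sym x) lerD.
Qed.

Lemma sup_mdist_ge (cX : compact [set: X]) (f g : X -> X) x :
  mdist (f x) (g x) <= sup_mdist f g.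
Proof.
have [B hB] := compact_mdist_bounded cX.
rewrite /sup_mdist; apply: ub_le_sup; last by exists x.
by exists B => _ [y _ <-].
Qed.

Lemma hoelder_small (a C e : R) : 0 < a -> 0 < e ->
  exists2 d : R, 0 < d & forall r, 0 <= r -> r < d -> C * r `^ a < e.
Proof.
(* [hoelder_for] leaves the sign of its constant open; C' is a positive substitute that can be
   divided by. *)
move=> a0 e0; pose C' := `|C| + 1; have C'0 : 0 < C' by rewrite ltr_wpDl.
exists ((e / C') `^ a^-1); first by rewrite powR_gt0// divr_gt0.
move=> r r0 rd; apply: (@le_lt_trans _ _ (C' * r `^ a)).
  by rewrite ler_wpM2r ?powR_ge0// (le_trans (ler_norm C))// lerDl.
rewrite mulrC -ltr_pdivlMr//.
have -> : e / C' = ((e / C') `^ a^-1) `^ a.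
  by rewrite -powRrM mulVf ?gt_eqF// powRr1// divr_ge0// ltW.
by apply: gt0_ltr_powR => //; rewrite nnegrE// powR_ge0.
Qed.

Lemma hoelder_continuous_continuous (U V : metricType R) (f : U -> V) :
  hoelder_continuous f -> continuous f.
Proof.
move=> [a [a0 a1 [C hC]]] x; apply/metricType_numDomainType.cvgrPdist_lt => e e0.
have [d d0 hd] := hoelder_small C a0 e0.
apply/metricType_numDomainType.nbhs_mdistP; exists d => //= y xy.
by apply: le_lt_trans (hC x y) _; apply: hd => //; exact: mdist_ge0.
Qed.

Lemma skew_product_continuous (alpha : R) (F : Sigma -> X -> X)
    (cX : compact [set: X]) (alpha0 : 0 < alpha) (hF : hoelder_into_C_alpha alpha F) :
  continuous (skew_product F).
Proof.
move=> [w t].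
suff c : (fun z : Sigma * X => F z.1 z.2) @ nbhs (w, t) --> F w t.
  apply: (@cvg_pair _ _ _ (nbhs (w, t)) (nbhs (left_shift w)) (nbhs (F w t))) => //.
  move=> B nB; exists (@left_shift R A M @^-1` B, setT) => /=.
    by split; [exact: left_shift_continuous|exact: filterT].
  by move=> [w' t'] [].
apply/metricType_numDomainType.cvgrPdist_lt => e e0.
have [h1 [a [a0 a1 [C hC]]]] := hF; have [C1 hC1] := h1 w.
have e2 : 0 < e / 2 by rewrite divr_gt0.
have [d d0 hd] := hoelder_small C1 alpha0 e2.
have [d' d'0 hd'] := hoelder_small C a0 e2.
exists ([set w' | mdist w w' < d'], [set t' | mdist t t' < d]) => /=.
  by split; apply/metricType_numDomainType.nbhs_mdistP; [exists d'|exists d].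
move=> [w' t'] [/= hw ht].
(* Moving first in the fibre uses only the Hoelder constant of the fixed map F w; moving then in the
   base, at t', is controlled by the uniform distance. *)
apply: (le_lt_trans (metric_triangle _ (F w t') _)); rewrite [ltRHS](splitr e).
apply: ltrD; first by apply: le_lt_trans (hC1 _ _) _; apply: hd => //; exact: mdist_ge0.
apply: le_lt_trans (sup_mdist_ge cX _ _ _) _.
by apply: le_lt_trans (hC _ _) _; apply: hd' => //; exact: mdist_ge0.
Qed.

Lemma skew_compact (cX : compact [set: X]) : compact [set: Sigma * X].
Proof.
rewrite -setXTT; exact: compact_setX shift_compact cX.
Qed.

End skew_topology.

(** * Entropy of the shift *)

Lemma cvg_natV (R : realType) : (fun n : nat => n%:R^-1 : R) @ \oo --> 0.
Proof.
apply/cvgrPdist_le => d d0; exists (Num.truncn d^-1).+1 => // n /= hn.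
have n0 : 0 < n%:R :> R by rewrite ltr0n; exact: leq_trans hn.
rewrite sub0r normrN ger0_norm ?invr_ge0// invf_ple ?posrE//.
by apply: ltW; apply: (lt_le_trans (truncnS_gt _)); rewrite ler_nat.
Qed.

(** * Approximation of Borel sets by window sets *)

Section borel_approximation.
Context {R : realType} {A : finType} {M : transition A}.
Local Notation Sigma := (markov_shift R M).
Context (m : probability (borel Sigma) R).
Let mu : set (borel Sigma) -> R := fine \o m.
Let hmu : fprob mu := fprob_probability m.

Definition approximable (B : set Sigma) := forall e, 0 < e -> exists N E,
  [/\ window_set N E, mu (B `\` E) <= e & mu (E `\` B) <= e].

Let window_measurable N (E : set Sigma) : window_set N E ->
  measurable (E : set (borel Sigma)).
Proof. by move=> /window_set_open; exact: borel_open. Qed.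

Let le2 (B C D : set (borel Sigma)) : measurable B -> measurable C -> measurable D ->
  B `<=` C `|` D -> mu B <= mu C + mu D.
Proof.
move=> mB mC mD h; apply: le_trans (fprob_leU hmu mC mD).
by apply: (fprob_sub hmu) => //; exact: measurableU.
Qed.

Lemma approximable_bigcup (F : (set (borel Sigma))^nat) :
  nondecreasing_seq F -> (forall n, measurable (F n)) ->
  (forall n, approximable (F n)) -> approximable (\bigcup_n F n).
Proof.
move=> ndF mF aF e e0; have mU : measurable (\bigcup_n F n) by exact: bigcup_measurable.
have cF := nondecreasing_cvg_mu (mu := m) mF mU ndF.
have cF' : mu \o F @ \oo --> mu (\bigcup_n F n).
  by apply: fine_cvg; rewrite fineK//; exact: fin_num_measure.
have e2 : 0 < e / 2 by rewrite divr_gt0.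
have [n _ /(_ n (leqnn n)) /= hn] := (cvgrPdist_le _ _).1 cF' _ e2.
have [N [E [wE h1 h2]]] := aF n _ e2; exists N, E.
have mE := window_measurable wE.
have Fn : F n `<=` \bigcup_n F n by move=> x Fx; exists n.
split => //; last first.
  apply: (@le_trans _ _ (mu (E `\` F n))).
    by apply: (fprob_sub hmu); [exact: measurableD..|apply: setDS].
  by apply: (le_trans h2); lra.
rewrite (splitr e); apply: (@le_trans _ _ (mu (\bigcup_n F n `\` F n) + mu (F n `\` E))).
  apply: le2; [exact: measurableD..|].
  by move=> x [Ux Ex]; have [Fx|Fx] := pselect (F n x); [right|left].
apply: lerD => //; move: hn; rewrite ler_norml => /andP[_].
apply: le_trans; rewrite -{2}(setDUK Fn) (fprobU hmu) ?setDIK//; last exact: measurableD.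
by rewrite addrAC subrr add0r.
Qed.

Lemma approximableC B : measurable (B : set (borel Sigma)) ->
  approximable B -> approximable (~` B).
Proof.
move=> mB aB e e0; have [N [E [wE h1 h2]]] := aB e e0; exists N, (~` E); split.
- by move=> w w' /agree_sym ww' Ew Ew'; apply: Ew; exact: wE ww' Ew'.
- by rewrite setDE setCK setIC -setDE.
- by rewrite setDE setCK setIC -setDE.
Qed.

Lemma approximableU (B C : set (borel Sigma)) : measurable B -> measurable C ->
  approximable B -> approximable C -> approximable (B `|` C).
Proof.
move=> mB mC aB aC e e0; have e2 : 0 < e / 2 by rewrite divr_gt0.
have [N [E [wE h1 h2]]] := aB _ e2; have [N' [E' [wE' h1' h2']]] := aC _ e2.
have mE := window_measurable wE; have mE' := window_measurable wE'.
exists (maxn N N'), (E `|` E'); split.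
- move=> w w' ww' [Ew|Ew]; [left; apply: wE Ew|right; apply: wE' Ew].
    by apply: agree_le ww'; exact: leq_maxl.
  by apply: agree_le ww'; exact: leq_maxr.
- rewrite (splitr e); apply: (@le_trans _ _ (mu (B `\` E) + mu (C `\` E'))); last exact: lerD.
  apply: le2; [by apply: measurableD; exact: measurableU|exact: measurableD..|].
  by move=> x [[Bx|Cx] /not_orP[Ex Ex']]; [left|right].
- rewrite (splitr e); apply: (@le_trans _ _ (mu (E `\` B) + mu (E' `\` C))); last exact: lerD.
  apply: le2; [by apply: measurableD; exact: measurableU|exact: measurableD..|].
  by move=> x [[Bx|Cx] /not_orP[Ex Ex']]; [left|right].
Qed.

Lemma window_approximable N (E : set Sigma) : window_set N E -> approximable E.
Proof.
by move=> wE e e0; exists N, E; rewrite setDv (fprob0 hmu); split => //; exact: ltW.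
Qed.

(** The measurable approximable sets form a sigma-algebra containing the open sets; countable unions
    reduce to increasing ones through partial unions. *)
Lemma borel_approximable (B : set (borel Sigma)) : measurable B -> approximable B.
Proof.
move=> mB; suff : (@measurable _ (borel Sigma)) `<=`
    [set B | measurable (B : set (borel Sigma)) /\ approximable B].
  by move=> /(_ B mB)[].
apply: smallest_sub; last first.
  move=> V oV; split; first exact: borel_open.
  (* The largest subset of V determined by the coordinates in [-N, N]; these sets increase to V
     because V is open. *)
  pose F N : set Sigma := [set w | [set w' | agree N w w'] `<=` V].
  have wF N : window_set N (F N).
    by move=> w w' ww' Fw w'' w'w''; apply: Fw; exact: agree_trans w'w''.
  have -> : V = \bigcup_n F n.
    apply/seteqP; split => [w Vw|w [n _ Fw]]; last by apply: Fw => k _; rewrite /differ_at !eqxx.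
    have /nbhs_agree[N hN] : nbhs w V by exact: open_nbhs_nbhs.
    by exists N.
  apply: approximable_bigcup => [n n' nn'|n|n].
  - by apply/subsetPset => w Fw w' ww'; apply: Fw; exact: agree_le ww'.
  - exact: window_measurable (wF n).
  - exact: window_approximable (wF n).
split.
- by split => //; apply: (@window_approximable 0).
- move=> C [mC aC]; rewrite setTD; split; [exact: measurableC|exact: approximableC].
- move=> C hC; have mC n : measurable (C n : set (borel Sigma)) by case: (hC n).
  split; first exact: bigcup_measurable.
  have H n : approximable (\big[setU/set0]_(i < n) C i).
    elim: n => [|n IH]; first by rewrite big_ord0; apply: (@window_approximable 0).
    rewrite big_ord_recr/=; apply: approximableU => //; last by case: (hC n).
    by apply: bigsetU_measurable => i _.
  rewrite -bigcup_bigsetU_bigcup.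
  apply: approximable_bigcup => // [n n' nn'|n].
    by apply/subsetPset; apply: subset_bigsetU.
  by apply: bigsetU_measurable => i _.
Qed.

End borel_approximation.

(** * The letter partition generates *)

Section generator.
Context {R : realType} {A : finType} {M : transition A}.
Local Notation Sigma := (markov_shift R M).
Local Notation T := (@left_shift R A M : borel Sigma -> borel Sigma).
Context (m : probability (borel Sigma) R) (inv : invariant_measure T m).
Let mu : set (borel Sigma) -> R := fine \o m.
Let hmu : fprob mu := fprob_probability m.

Lemma left_shift_measurable (B : set (borel Sigma)) : measurable B -> measurable (T @^-1` B).
Proof. by apply: borel_continuous_measurable; exact: left_shift_continuous. Qed.

Let mT := left_shift_measurable.

Let muT (B : set (borel Sigma)) : measurable B -> mu (T @^-1` B) = mu B.
Proof. by move=> mB; rewrite /mu/= inv. Qed.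

Let a0 : borel Sigma -> A := letter.

Lemma labelling_letter : labelling a0.
Proof.
move=> B; apply: borel_open; apply: (@window_set_open _ _ _ 0) => w w' /agreeP h /=.
by rewrite /a0/letter; have [-> _] := h 0%N (leqnn _).
Qed.

Definition window N (w : borel Sigma) : (N + N).+1.-tuple A :=
  [tuple w (j%:Z - N%:Z) | j < (N + N).+1].

Lemma windowP N w w' : window N w = window N w' <-> agree N w w'.
Proof.
split=> [e|h]; last first.
  apply: eq_from_tnth => j; rewrite !tnth_mktuple; apply: (agree_coord h).
  by have := ltn_ord j; lia.
have H i : (i <= N + N)%N -> w (i%:Z - N%:Z) = w' (i%:Z - N%:Z).
  rewrite -ltnS => iN; have := congr1 (fun t => tnth t (Ordinal iN)) e.
  by rewrite !tnth_mktuple.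
apply/agreeP => n nN; split.
  have := H (n + N)%N; rewrite PoszD addrK; apply; lia.
have := H (N - n)%N; have -> : (N - n)%N%:Z - N%:Z = - n%:Z by lia.
by apply; lia.
Qed.

Lemma labelling_window N : labelling (window N).
Proof.
move=> B; apply: borel_open; apply: (@window_set_open _ _ _ N) => w w' /windowP h /=.
by rewrite h.
Qed.

Lemma ent_given_window (I : finType) (f : borel Sigma -> I) e : labelling f -> 0 < e ->
  exists N, ent mu (fun w => (f w, window N w)) - ent mu (window N) <= e.
Proof.
move=> hf e0; pose k : R := #|I|.+1%:R; have k0 : 0 < k by rewrite ltr0n.
(* Each i contributes three terms to [ent_pair_approx], each to be at most d. The second is a mass
   divided by d, hence the requirement d * d in [d']. *)
pose d := e / (3 * k); have d0 : 0 < d by rewrite divr_gt0// mulr_gt0.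
pose d' := Num.min d (d * d); have d'0 : 0 < d' by rewrite lt_min d0 mulr_gt0.
have /choice[NE hNE] (i : I) : exists NE : nat * set Sigma,
    [/\ window_set NE.1 NE.2, mu (f @^-1` [set i] `\` NE.2) <= d' &
        mu (NE.2 `\` f @^-1` [set i]) <= d'].
  have [N [E h]] := borel_approximable m (hf [set i]) d'0.
  by exists (N, E).
pose N := \max_i (NE i).1; exists N.
have hE i w w' : agree N w w' -> (NE i).2 w -> (NE i).2 w'.
  have [h _ _] := hNE i; move=> ww'; apply: h; apply: agree_le ww'.
  exact: (leq_bigmax i).
apply: (le_trans (ent_pair_approx hmu (E := fun i => (NE i).2) hf
  (labelling_window (N := N)) _ d0 _)).
- by move=> i; apply: borel_open; apply: (@window_set_open _ _ _ N) => w w'; exact: hE.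
- by move=> i s s' /windowP; exact: hE.
apply: (@le_trans _ _ (\sum_(i : I) (d + d + d))).
  apply: ler_sum => i _; have [_ h1 h2] := hNE i; rewrite lerD2r; apply: lerD.
    by apply: (le_trans h2); rewrite ge_min lexx.
  by rewrite ler_pdivrMr//; apply: (le_trans h1); rewrite ge_min lexx orbT.
rewrite sumr_const -[_ *+ _]mulr_natl.
have -> : d + d + d = e / k by rewrite /d; field; rewrite gt_eqF.
rewrite mulrCA ler_piMr ?ltW//.
by rewrite ltr_pdivrMr// mul1r ltr_nat.
Qed.

Lemma ent_letter_cvg : exists h,
  (fun n => n%:R^-1 * ent mu (itin T n a0)) @ \oo --> h /\
  forall n, (0 < n)%N -> h <= n%:R^-1 * ent mu (itin T n a0).
Proof. exact: (ent_itin_cvg mT hmu muT labelling_letter). Qed.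

Let h0 := sval (cid ent_letter_cvg).

(* Kolmogorov-Sinai: the partition according to the letter at 0 generates. *)
Lemma ent_rate_le (I : finType) (f : borel Sigma -> I) h : labelling f ->
  (fun n => n%:R^-1 * ent mu (itin T n f)) @ \oo --> h -> h <= h0.
Proof.
move=> hf cf; apply/ler_addgt0Pr => e e0.
have [N hN] := ent_given_window hf e0.
have [c0 _] := svalP (cid ent_letter_cvg); rewrite -/h0 in c0.
(* Forward itineraries do not see negative coordinates. After N shifts the window on [-N, N] becomes
   the forward itinerary g, and by invariance the shift costs nothing. *)
pose g : borel Sigma -> (N + N).+1.-tuple A := itin T (N + N).+1 a0.
have ha0 := labelling_letter.
have hg : labelling g by exact: labelling_itin.
have hfN : labelling (f \o iter N T) by exact: labelling_iter.
have gE w : g w = window N (iter N T w).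
  apply: eq_from_tnth => j; rewrite !tnth_mktuple /a0 /letter !iter_shift add0r.
  by rewrite subrK.
have eN : ent mu (fun w => ((f \o iter N T) w, g w)) - ent mu g <= e.
  apply: le_trans hN; rewrite -(ent_iter mT muT N (labelling_window (N := N))).
  have hfw := labelling_pair hf (labelling_window (N := N)).
  rewrite -(ent_iter mT muT N hfw).
  have -> : g = window N \o iter N T by apply/funext => w; exact: gE.
  exact: lexx.
(* An n-itinerary of g reads n + 2 N letters; the 2 N extra ones cost a constant that disappears
   after division by n. *)
have bound n : ent mu (itin T n f) <=
    ent mu (itin T n a0) + ent mu (itin T (N + N) a0) + n%:R * e.
  have hfn : labelling (itin T n f) by exact: labelling_itin.
  rewrite -(ent_iter mT muT N hfn).
  have hgn : labelling (itin T n g) by exact: labelling_itin.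
  have hpn : labelling (itin T n (fun w => ((f \o iter N T) w, g w))).
    by apply: (labelling_itin mT); exact: labelling_pair.
  apply: (@le_trans _ _ (ent mu (itin T n (fun w => ((f \o iter N T) w, g w))))).
    apply: (ent_le hmu) => // s s' /itinP es; apply/itinP => j jn.
    have /pair_equal_spec[/= + _] := es j jn.
    by rewrite -!iterD addnC.
  apply: (le_trans (ent_itin_pair mT hmu muT n hfN hg)).
  apply: lerD; last by rewrite ler_wpM2l.
  apply: le_trans (ent_itin_subadditive mT hmu muT n (N + N) ha0).
  have haN : labelling (itin T (n + (N + N)) a0) by exact: labelling_itin.
  apply: (ent_le hmu) => // s s' /itinP es; apply/itinP => j jn.
  by apply/itinP => i iN; rewrite -!iterD; apply: es; lia.
have c1 : (fun n => n%:R^-1 * ent mu (itin T n a0) + n%:R^-1 * ent mu (itin T (N + N) a0) + e)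
    @ \oo --> h0 + 0 * ent mu (itin T (N + N) a0) + e.
  apply: cvgD; last exact: cvg_cst.
  apply: cvgD => //; apply: cvgM; last exact: cvg_cst.
  exact: cvg_natV.
rewrite mul0r addr0 in c1.
apply: ler_cvg_to cf c1 _; exists 1%N => // n /= n0.
have n0R : 0 < n%:R :> R by rewrite ltr0n.
by rewrite ler_pdivrMl// !mulrDr !mulVKf ?gt_eqF.
Qed.

Lemma partition_label k (P : 'I_k -> set (borel Sigma)) : measurable_partition P ->
  exists2 f : borel Sigma -> 'I_k, labelling f &
    forall n u, dynamical_join T P u = itin T n f @^-1` [set u].
Proof.
move=> [mP [cP tP _]].
have /choice[f hf] (w : borel Sigma) : exists i, P i w.
  have : [set: borel Sigma] w by [].
  by rewrite -cP => -[i _ Pi]; exists i.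
have fP i : f @^-1` [set i] = P i.
  apply/seteqP; split => w /=; first by move=> <-.
  move=> Pi; apply: contrapT => fi.
  by apply: fi; apply: (tP (f w) i Logic.I Logic.I); exists w; split => //; exact: hf.
exists f; first by apply: labelling1 => i; rewrite fP.
move=> n u; apply/seteqP; split => w /=.
  move=> h; apply: eq_from_tnth => j; rewrite tnth_mktuple.
  by have := h j Logic.I; rewrite /= -fP.
by move=> <- j _ /=; rewrite tnth_mktuple -fP.
Qed.

Lemma partition_entropyE k (P : 'I_k -> set (borel Sigma)) f h :
  (forall n u, dynamical_join T P u = itin T n f @^-1` [set u]) ->
  (fun n => n%:R^-1 * ent mu (itin T n f)) @ \oo --> h ->
  entropy_wrt T m P = h.
Proof.
move=> e c; apply/cvg_lim => //; rewrite [X in X @ _ --> _](_ : _ =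
  fun n => n%:R^-1 * ent mu (itin T n f))//.
apply/funext => n; congr (_ * _); rewrite /partition_entropy /ent; congr (- _).
by apply: eq_bigr => u _; rewrite e.
Qed.

(** The greatest-lower-bound form is what semicontinuity uses: lower bounds are checked for one
    block length at a time. *)
Lemma metric_entropy_letter : exists2 h, metric_entropy T m = h%:E &
  (forall n, (0 < n)%N -> h <= n%:R^-1 * ent mu (itin T n a0)) /\
  (forall c, (forall n, (0 < n)%N -> c <= n%:R^-1 * ent mu (itin T n a0)) -> c <= h).
Proof.
have [c0 l0] := svalP (cid ent_letter_cvg); rewrite -/h0 in c0 l0.
exists h0; last first.
  split => // c hc.
  by apply: ler_cvg_to (cvg_cst c) c0 _; exists 1%N => // n /= n0; exact: hc.
apply/eqP; rewrite eq_le; apply/andP; split.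
  apply: ge_ereal_sup => _ [k [P [mP ->]]]; rewrite lee_fin.
  have [f hf e] := partition_label mP.
  have [h [ch _]] := ent_itin_cvg mT hmu muT hf.
  by rewrite (partition_entropyE e ch); exact: ent_rate_le ch.
(* A partition in the sense of [measurable_partition] has nonempty cells, so only letters that occur
   in some sequence may index it. *)
pose L := [set a : A | `[< exists w : Sigma, letter w = a >]]%SET.
apply: ereal_sup_ubound; exists #|L|, (fun i => a0 @^-1` [set enum_val i]).
have mP : measurable_partition (fun i : 'I_#|L| => a0 @^-1` [set enum_val i]).
  split; first by move=> i; exact: labelling_letter.
  split.
  - apply/seteqP; split => // w _.
    have wL : a0 w \in L by rewrite inE; apply/asboolP; exists w.
    by exists (enum_rank_in wL (a0 w)) => //=; rewrite enum_rankK_in.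
  - by move=> i j _ _ [w [/= ->]]; exact: enum_val_inj.
  - by move=> i _; have := enum_valP i; rewrite inE => /asboolP[w hw]; exists w.
split => //; congr EFin; apply/esym.
have [f hf e] := partition_label mP.
have fa w : a0 w = enum_val (f w).
  have : dynamical_join T (fun i : 'I_#|L| => a0 @^-1` [set enum_val i]) (itin T 1 f w) w.
    by rewrite e.
  by move=> /(_ ord0 Logic.I) /=; rewrite tnth_mktuple.
apply: (partition_entropyE e).
have -> : (fun n => n%:R^-1 * ent mu (itin T n f)) =
    (fun n => n%:R^-1 * ent mu (itin T n a0)); last exact: c0.
apply/funext => n; congr (_ * _).
apply: (ent_eq hmu); [exact: labelling_itin| |].
  by apply: labelling_itin => //; exact: labelling_letter.
move=> s s'; split => /itinP es; apply/itinP => j jn.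
  by apply: enum_val_inj; rewrite -!fa es.
by rewrite !fa (es j jn).
Qed.

End generator.

(** * Free energy *)

Section atomic.
Context d {Z : measurableType d} {R : realType} (J : finType) (q : J -> R) (z : J -> Z).
Hypotheses (q0 : forall x, 0 <= q x) (q1 : \sum_x q x = 1).

Definition atomic (B : set Z) : R := \sum_x q x * \1_B (z x).

Lemma fprob_atomic : fprob atomic.
Proof.
split.
- by rewrite -[RHS]q1; apply: eq_bigr => x _; rewrite indicT mulr1.
- by move=> B _; apply: sumr_ge0 => x _; rewrite mulr_ge0// indicE.
- move=> B C _ _ BC; rewrite /atomic -big_split; apply: eq_bigr => x _ /=.
  rewrite -mulrDr !indicE in_setU; congr (_ * _).
  have [xB|xB] := boolP (z x \in B); have [xC|xC] := boolP (z x \in C) => //=;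
    rewrite ?addr0 ?add0r//.
  have : (B `&` C) (z x) by split; rewrite -in_setE.
  by rewrite BC.
Qed.

Lemma stairs_integral_atomic phi C N K : (forall z, `|phi z| <= C) -> (0 < N)%N ->
  2 * C * N%:R <= K%:R ->
  \sum_x q x * phi (z x) <= stairs_integral phi C N K atomic + N%:R^-1.
Proof.
move=> phiC N0 hK.
have -> : stairs_integral phi C N K atomic + N%:R^-1 =
    \sum_x q x * (- C + N%:R^-1 * stairs K (N%:R * (phi (z x) + C)) + N%:R^-1).
  have E : \sum_(k < K) atomic [set z | k.+1%:R <= N%:R * (phi z + C)] =
      \sum_x q x * stairs K (N%:R * (phi (z x) + C)).
    rewrite /atomic exchange_big/=; apply: eq_bigr => x _.
    by rewrite /stairs !mulr_sumr; apply: eq_bigr => k _; rewrite (level_indic phi C).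
  rewrite /stairs_integral E.
  transitivity (\sum_x (q x * - C + N%:R^-1 * (q x * stairs K (N%:R * (phi (z x) + C)))
      + q x * N%:R^-1)).
    by rewrite !big_split/= -!mulr_suml -mulr_sumr q1 !mul1r.
  by apply: eq_bigr => x _; ring.
apply: ler_sum => x _; rewrite ler_wpM2l//.
by have /andP[] := stairs_bounds (phiC (z x)) N0 hK.
Qed.

End atomic.

Section concavity.
Context d {S : measurableType d} {R : realType}.

(** On each cell, with x_i its masses and y their average, the tangent bound gives - x_i ln x_i <= y
    - x_i - x_i ln y; the linear terms cancel on summing over i. *)
Lemma ent_concave (n : nat) (mu_ : nat -> set S -> R) (mu : set S -> R)
    (I : finType) (f : S -> I) : (0 < n)%N -> (forall i, fprob (mu_ i)) -> labelling f ->
  (forall B, mu B = n%:R^-1 * \sum_(i < n) mu_ i B) ->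
  n%:R^-1 * \sum_(i < n) ent (mu_ i) f <= ent mu f.
Proof.
move=> n0 hmu hf muE; have n0R : 0 < n%:R :> R by rewrite ltr0n.
rewrite /ent -sumrN.
under eq_bigr do rewrite -sumrN.
rewrite exchange_big/= mulr_sumr; apply: ler_sum => j _.
set B := f @^-1` [set j]; have mB : measurable B by exact: hf.
have x0 i : 0 <= mu_ i B by exact: fprob_ge0 (hmu i) _ mB.
have xn : \sum_(i < n) mu_ i B = n%:R * mu B by rewrite muE mulVKf ?gt_eqF.
have y0 : 0 <= mu B by rewrite muE mulr_ge0 ?invr_ge0 ?ler0n// sumr_ge0.
rewrite ler_pdivrMl//.
have xy (i : 'I_n) : 0 < mu_ i B -> 0 < mu B.
  move=> xi; rewrite muE mulr_gt0 ?invr_gt0// (bigD1 i)//= ltr_wpDr// sumr_ge0//.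
apply: (@le_trans _ _ (\sum_(i < n) (mu B - mu_ i B - mu_ i B * ln (mu B)))).
  apply: ler_sum => i _.
  by have := mulr_ln_sub_le (x0 i) y0 (xy i); rewrite mulrBr; lra.
rewrite !big_split/= !sumrN -mulr_suml xn sumr_const card_ord -[_ *+ _]mulr_natl.
by rewrite subrr add0r mulrN mulrA.
Qed.

End concavity.

(** * Limits of free energies for the skew product *)

Section skew.
Context {R : realType} {A : finType} {M : transition A} {X : pmetricType R}.
Local Notation Sigma := (markov_shift R M).
Local Notation Z := (Sigma * X)%type.
Variables (alpha : R) (F : Sigma -> X -> X) (phi : Z -> R).
Hypotheses (cX : compact [set: X]) (alpha_gt0 : 0 < alpha)
  (hF : hoelder_into_C_alpha alpha F)
  (hphi : @hoelder_continuous R Z R^o phi).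
Local Notation T := (@left_shift R A M : borel Sigma -> borel Sigma).
Local Notation G := (skew_product F : borel Z -> borel Z).

Let cG : continuous (skew_product F) := skew_product_continuous cX alpha_gt0 hF.
Let cphi : continuous phi.
Proof. exact: (@hoelder_continuous_continuous R Z R^o phi hphi). Qed.
Let cZ : compact [set: Z] := skew_compact cX.
Let hZ : hausdorff_space Z := @metric_hausdorff R Z.

Let phi_bound : exists C, forall z, `|phi z| <= C.
Proof.
have c : {within [set: Z], continuous (fun z => `|phi z|)}.
  by apply: continuous_subspaceT => z; apply: cvg_norm; exact: cphi.
have [z0 _ hz] := compact_EVT_max (ex_intro _ (point : Z) I) cZ c.
by exists `|phi z0| => z; apply: hz; rewrite inE.
Qed.
Let C := sval (cid phi_bound).
Let phiC z : `|phi z| <= C := svalP (cid phi_bound) z.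

Let mG (B : set (borel Z)) : measurable B -> measurable (G @^-1` B).
Proof. exact: borel_continuous_measurable. Qed.

Let cfst : continuous (fst : Z -> Sigma).
Proof. by move=> z; exact: cvg_fst. Qed.

Let mphi : measurable_fun setT (phi : borel Z -> R).
Proof. exact: borel_continuous_measurable_fun. Qed.

Definition base_letter : borel Z -> A := @letter R A M \o fst.

Lemma iter_skew j (z : Z) : (iter j (skew_product F) z).1 = iter j (@left_shift R A M) z.1.
Proof. by elim: j => //= j ->. Qed.

Lemma itin_base n (z : Z) :
  itin (skew_product F) n base_letter z = itin (@left_shift R A M) n letter z.1.
Proof.
by apply: eq_from_tnth => j; rewrite !tnth_mktuple /base_letter/= iter_skew.
Qed.

Lemma itin_base_open n (u : n.-tuple A) :
  open (itin (skew_product F) n base_letter @^-1` [set u] : set Z).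
Proof.
have -> : (itin (skew_product F) n base_letter @^-1` [set u] : set Z) =
    fst @^-1` (itin (@left_shift R A M) n letter @^-1` [set u]).
  by apply/seteqP; split => z /=; rewrite itin_base.
apply: open_comp; first by move=> z _; exact: cfst.
apply: window_set_open; exact: window_set_itin.
Qed.

Lemma labelling_base : labelling base_letter.
Proof.
apply: labelling1 => a; apply: borel_open.
have -> : base_letter @^-1` [set a] = itin (skew_product F) 1 base_letter @^-1` [set [tuple a]].
  apply/seteqP; split => z /=.
    by move=> e; apply: eq_from_tnth => j; rewrite tnth_mktuple ord1 /= e.
  by move=> /(congr1 (fun t => tnth t ord0)); rewrite tnth_mktuple.
exact: itin_base_open.
Qed.

Let lG n : labelling (itin G n base_letter).
Proof. by apply: labelling_itin => //; exact: labelling_base. Qed.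

(** Expresses the entropy of the projected measure on the product itself, through itineraries of the
    base letter. The limit arguments can then stay on the product, and the free energy is seen to be
    finite. *)
Lemma fiber_free_energyE (nu : probability (borel Z) R) :
  invariant_measure G nu -> exists h,
  [/\ fiber_free_energy phi nu = (h + fine (\int[nu]_z (phi z)%:E)%E)%:E,
   (forall n, (0 < n)%N -> h <= n%:R^-1 * ent (fine \o nu) (itin G n base_letter)) &
   (forall c, (forall n, (0 < n)%N -> c <= n%:R^-1 * ent (fine \o nu) (itin G n base_letter)) ->
      c <= h)].
Proof.
(* [p] is the pushforward by [fst], packaged below as a probability so that [metric_entropy_letter]
   applies to it. *)
move=> inv; pose p (B : set (borel Sigma)) : \bar R := nu (fst @^-1` B).
have mfst (B : set (borel Sigma)) : measurable B -> measurable (fst @^-1` B : set (borel Z)).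
  exact: borel_continuous_measurable.
have p0 : p set0 = 0%E by rewrite /p preimage_set0 measure0.
have pge0 B : (0 <= p B)%E by rewrite /p measure_ge0.
have psig : semi_sigma_additive p.
  move=> E mE tE mUE; rewrite /p preimage_bigcup.
  apply: measure_semi_sigma_additive.
  - by move=> n; exact: mfst.
  - apply/trivIsetP => /= i j _ _ ij; rewrite -preimage_setI.
    by move/trivIsetP : tE => /(_ _ _ _ _ ij) ->//; rewrite preimage_set0.
  - by rewrite -preimage_bigcup; exact: mfst.
pose pm := isMeasure.Build _ _ _ p p0 pge0 psig.
pose pM : {measure set (borel Sigma) -> \bar R} := HB.pack p pm.
have pT : pM setT = 1%E by rewrite /= /p preimage_setT probability_setT.
pose pp := Measure_isProbability.Build _ _ _ pM pT.
pose m : probability (borel Sigma) R := HB.pack p pm pp.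
have minv : invariant_measure T m.
  move=> B mB; rewrite /m/= /p -[RHS]inv; last exact: mfst.
  by congr (nu _); apply/seteqP; split.
have [h hE [h1 h2]] := metric_entropy_letter minv.
have eE n : ent (fine \o m) (itin T n (letter : borel Sigma -> A)) =
    ent (fine \o nu) (itin G n base_letter).
  rewrite /ent; congr (- _); apply: eq_bigr => u _.
  suff -> : (fine \o m) (itin T n (letter : borel Sigma -> A) @^-1` [set u]) =
      (fine \o nu) (itin G n base_letter @^-1` [set u]) by [].
  rewrite /= /p; congr (fine (nu _)).
  by apply/seteqP; split => z /=; rewrite itin_base.
exists h; split.
- rewrite /fiber_free_energy EFinD -(integral_fine nu mphi phiC); congr (_ + _)%E.
  exact: hE.
- by move=> n n0; rewrite -eE; exact: h1.
- by move=> c hc; apply: h2 => n n0; rewrite eE; exact: hc.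
Qed.

(** For a fixed block length n, entropy and energy are both semicontinuous along U, each costing e /
    3; the infimum over n is taken only after the limit. Hence c may be tested with a set of indices
    that depends on n and e. *)
Lemma limit_free_energy (I : Type) (U : set_system I) (UU : UltraFilter U)
    (mu_ : I -> set (borel Z) -> R) (e_ : I -> R) :
  (forall i, fprob (mu_ i)) ->
  (forall B, measurable B -> (fun i => mu_ i (G @^-1` B) - mu_ i B) @ U --> (0 : R)) ->
  (forall N K, (0 < N)%N -> 2 * C * N%:R <= K%:R -> forall i,
    e_ i <= stairs_integral phi C N K (mu_ i) + N%:R^-1) ->
  exists nu : probability (borel Z) R, invariant_measure G nu /\
    forall c, (forall n e, (0 < n)%N -> 0 < e -> \forall i \near U,
        c <= n%:R^-1 * ent (mu_ i) (itin G n base_letter) + e_ i + e) ->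
      (c%:E <= fiber_free_energy phi nu)%E.
Proof.
move=> hmu inv he; have [nu [nuG nuC]] := limit_measure hZ cZ hmu cG inv.
exists nu; split => // c hc; have [h [-> _ h2]] := fiber_free_energyE nuG.
rewrite lee_fin -lerBlDr; apply: h2 => n n0; rewrite lerBlDr.
apply/ler_addgt0Pr => e e0; have n0R : 0 < n%:R :> R by rewrite ltr0n.
have e3 : 0 < e / 3 by rewrite divr_gt0.
have H1 := hc n _ n0 e3.
have H2 := stairs_usc nuC cphi phiC he e3.
have H3 := ent_usc hmu nuC (@itin_base_open n) (mulr_gt0 n0R e3).
suff : \forall i \near U, c <=
    n%:R^-1 * ent (fine \o nu) (itin G n base_letter) + fine (\int[nu]_z (phi z)%:E)%E + e.
  by move=> /filter_ex[].
apply: filterS3 H1 (H2 UU) (H3 UU) => i h1 h3 h4.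
have : n%:R^-1 * ent (mu_ i) (itin G n base_letter) <=
    n%:R^-1 * ent (fine \o nu) (itin G n base_letter) + e / 3.
  by rewrite ler_pdivrMl// mulrDr mulVKf ?gt_eqF.
lra.
Qed.

Lemma birkhoff_continuous n t : continuous (fun w => birkhoff_sum F phi n (w, t)).
Proof.
have cI k : continuous (iter k (skew_product F)).
  elim: k => [|k IH] z; first exact: cvg_id.
  apply: (@continuous_comp _ _ _ (iter k (skew_product F)) (skew_product F)).
    exact: IH.
  exact: cG.
have c1 : continuous (fun w : Sigma => (w, t)).
  move=> w; apply: (@cvg_pair _ _ _ (nbhs w) (nbhs w) (nbhs t)) => //.
  exact: cvg_cst.
elim: n => [|n IH].
  have -> : (fun w => birkhoff_sum F phi 0 (w, t)) = cst 0.
    by apply/funext => w'; rewrite /birkhoff_sum big_ord0.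
  exact: cst_continuous.
have -> : (fun w => birkhoff_sum F phi n.+1 (w, t)) = (fun w => birkhoff_sum F phi n (w, t)) \+
    (fun w => phi (iter n (skew_product F) (w, t))).
  by apply/funext => w'; rewrite /birkhoff_sum big_ord_recr.
move=> w; apply: continuousD; first exact: IH.
apply: (@continuous_comp _ _ _ (fun w : Sigma => (w, t)) (phi \o iter n (skew_product F))).
  exact: c1.
by apply: continuous_comp; [exact: cI|exact: cphi].
Qed.

(** Compactness of the cylinder and continuity of the Birkhoff sum give a maximizer, which excludes
    the default value in [theta]. *)
Lemma theta_cylinder n (u : n.-tuple A) t : @admissible R A M n u ->
  cylinder u (theta F phi u t).
Proof.
move=> adm; have wc : window_set n (cylinder u : set Sigma).
  by rewrite cylinderE; exact: window_set_itin.
have cc : compact (cylinder u : set Sigma).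
  by apply: subclosed_compact (window_set_closed wc) shift_compact _.
have cont : {within cylinder u, continuous (fun w => birkhoff_sum F phi n (w, t))}.
  by apply: continuous_subspaceT; exact: birkhoff_continuous.
have [w wu hw] := compact_EVT_max adm cc cont.
have : [set w | cylinder u w /\ forall w', cylinder u w' ->
    birkhoff_sum F phi n (w', t) <= birkhoff_sum F phi n (w, t)] w.
  by rewrite inE in wu; split => // w' w'u; apply: hw; rewrite inE.
by move=> /(xgetI point)[].
Qed.

Let adm n : pred (n.-tuple A) := fun u => `[< @admissible R A M n u >].

Definition fiber_pressure n (t : X) : R := n%:R^-1 * ln (\sum_(u : n.-tuple A | adm u)
  expR (birkhoff_sum F phi n (theta F phi u t, t))).

(* The Gibbs weights exp(phi^(n)) on the points theta_u attain equality in
   Gibbs' variational principle; averaging along the orbit makes the measure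
   almost invariant at the cost, by concavity, of no entropy. *)
Lemma gibbs_average n (t : X) : (0 < n)%N ->
  exists (mu : set (borel Z) -> R) (e : R), [/\ fprob mu,
   (forall B, measurable B -> `|mu (G @^-1` B) - mu B| <= n%:R^-1),
   (forall N K, (0 < N)%N -> 2 * C * N%:R <= K%:R ->
     e <= stairs_integral phi C N K mu + N%:R^-1) &
   forall m, (0 < m)%N -> fiber_pressure n t <=
     m%:R^-1 * ent mu (itin G m base_letter) + e + n%:R^-1 * (2 * #|{: m.-tuple A}|%:R)].
Proof.
move=> n0; have n0R : 0 < n%:R :> R by rewrite ltr0n.
pose z (u : n.-tuple A) : borel Z := (theta F phi u t, t).
pose S u := birkhoff_sum F phi n (z u).
pose Zn := \sum_(u | adm u) expR (S u).
(* An inadmissible word has an empty cylinder and [theta] is then the default point, so its atom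
   must carry no mass. *)
pose p u := if adm u then expR (S u) / Zn else 0.
have Zn0 : 0 < Zn.
  pose u0 := itin (@left_shift R A M) n letter (point : Sigma).
  have au : adm u0 by apply/asboolP; exists point; rewrite cylinderE.
  rewrite /Zn (bigD1 u0)//=; apply: ltr_wpDr; last exact: expR_gt0.
  by apply: sumr_ge0 => u _; exact: expR_ge0.
have p0 u : 0 <= p u by rewrite /p; case: ifP => // _; rewrite divr_ge0 ?expR_ge0// ltW.
have p1 : \sum_u p u = 1.
  by rewrite /p -big_mkcond/= -mulr_suml divff// gt_eqF.
pose sigma := atomic p z.
have fsigma : fprob sigma := fprob_atomic z p0 p1.
pose sigmai i (B : set (borel Z)) := sigma (iter i G @^-1` B).
have mGi i (B : set (borel Z)) : measurable B -> measurable (iter i G @^-1` B).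
  exact: measurable_preimage_iter.
have fsigmai i : fprob (sigmai i).
  have [s1 s2 s3] := fsigma; split; first by rewrite /sigmai preimage_setT.
    by move=> B mB; apply: s2; exact: mGi.
  move=> B D mB mD BD; rewrite /sigmai preimage_setU; apply: s3; [exact: mGi|exact: mGi|].
  by rewrite -preimage_setI BD preimage_set0.
pose q (x : 'I_n * n.-tuple A) := n%:R^-1 * p x.2.
pose zz (x : 'I_n * n.-tuple A) : borel Z := iter x.1 G (z x.2).
have q0 x : 0 <= q x by rewrite mulr_ge0// invr_ge0 ler0n.
have pairE (h : 'I_n -> n.-tuple A -> R) :
    \sum_x h x.1 x.2 = \sum_(i < n) \sum_u h i u by rewrite pair_bigA.
have q1 : \sum_x q x = 1.
  rewrite (pairE (fun _ u => n%:R^-1 * p u)) -mulr_sumr p1 mulr1.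
  by rewrite sumr_const card_ord -[_ *+ _]mulr_natl divff// gt_eqF.
pose mu := atomic q zz.
have muE B : mu B = n%:R^-1 * \sum_(i < n) sigmai i B.
  rewrite /mu /atomic (pairE (fun i u => n%:R^-1 * p u * \1_B (iter i G (z u)))).
  rewrite mulr_sumr; apply: eq_bigr => i _; rewrite /sigmai /sigma /atomic mulr_sumr.
  by apply: eq_bigr => u _; rewrite -mulrA.
pose e := \sum_x q x * phi (zz x).
exists mu, e; split.
- exact: fprob_atomic.
- move=> B mB.
  (* The orbit average telescopes, leaving two end terms in [0, 1]. *)
  have -> : mu (G @^-1` B) - mu B = n%:R^-1 * (sigmai n B - sigmai 0%N B).
    have s i : sigmai i (G @^-1` B) = sigmai i.+1 B by [].
    rewrite !muE -mulrBr; congr (_ * _); under eq_bigr do rewrite s.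
    rewrite -sumrB -(big_mkord xpredT (fun i => sigmai i.+1 B - sigmai i B)).
    by rewrite telescope_sumr.
  rewrite normrM ger0_norm ?invr_ge0 ?ler0n// ler_piMr ?invr_ge0 ?ler0n//.
  have a0 := fprob_ge0 (fsigmai n) mB; have a1 := fprob_le1 (fsigmai n) mB.
  have b0 := fprob_ge0 (fsigmai 0%N) mB; have b1 := fprob_le1 (fsigmai 0%N) mB.
  by rewrite ler_norml; apply/andP; split; lra.
- by move=> N K N0 hK; exact: stairs_integral_atomic.
move=> m m0; have m0R : 0 < m%:R :> R by rewrite ltr0n.
have itz u : adm u -> itin G n base_letter (z u) = u.
  move=> /asboolP au; have := theta_cylinder t au; rewrite cylinderE => /= h.
  by rewrite -[RHS]h; exact: itin_base.
(* The atom of each admissible v has itinerary v by [itz], so a cell contains the atom of its own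
   word and no other atom of positive weight. *)
have sp u : sigma (itin G n base_letter @^-1` [set u]) = p u.
  rewrite /sigma /atomic (bigD1 u)//= big1 ?addr0; last first.
    move=> v vu; rewrite /p; case: ifP => [av|_]; last by rewrite mul0r.
    rewrite indicE memNset ?mulr0//= => /=; rewrite itz// => vu'.
    by rewrite vu' eqxx in vu.
  rewrite /p; case: ifP => [au|_]; last by rewrite mul0r.
  by rewrite indicE mem_set ?mulr1//=; exact: itz.
have eE : e = n%:R^-1 * \sum_u p u * S u.
  rewrite /e (pairE (fun i u => n%:R^-1 * p u * phi (iter i G (z u)))) exchange_big/=.
  rewrite mulr_sumr; apply: eq_bigr => u _; rewrite /S /birkhoff_sum mulrA mulr_sumr.
  exact: eq_bigr.
(* Equality case of Gibbs' principle: - ln (p u) = ln Zn - S u on admissible words, averaged with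
   the weights p. *)
have entE : ent sigma (itin G n base_letter) = ln Zn - \sum_u p u * S u.
  rewrite /ent -[ln Zn]mul1r -p1 mulr_suml -sumrB -sumrN; apply: eq_bigr => u _.
  rewrite sp /p; case: ifP => [au|_]; last by rewrite !mul0r subrr oppr0.
  by rewrite ln_div ?posrE ?expR_gt0// expRK; ring.
have -> : fiber_pressure n t = n%:R^-1 * ent sigma (itin G n base_letter) + e.
  rewrite eE entE -mulrDr subrK /fiber_pressure; congr (_ * ln _).
rewrite addrAC lerD2r.
have cc := ent_concave n0 fsigmai (@lG m) muE.
set B : R := #|{: m.-tuple A}|%:R; set D := \sum_(i < n) _ in cc.
(* The entropy of [sigma] along the i-th iterate is that of its image [sigmai i], so [D] is also the
   sum over windows. Concavity then bounds [D] by n times the entropy of [mu], and the error divided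
   by m n is 2 B / n. *)
have W : m%:R * ent sigma (itin G n base_letter) <= D + (m + m)%:R * B.
  exact: (ent_itin_windows mG n m fsigma labelling_base).
rewrite ler_pdivrMl// -(ler_pM2l m0R); apply: (le_trans W).
have -> : m%:R * (n%:R * (m%:R^-1 * ent mu (itin G m base_letter) + n%:R^-1 * (2 * B))) =
    n%:R * ent mu (itin G m base_letter) + (m + m)%:R * B.
  by rewrite natrD; field; rewrite !gt_eqF.
by rewrite lerD2r -ler_pdivrMl.
Qed.

(** The fibre point varies with the length, as the supremum over t in [poe] precedes the limit.
    Lengths are n + 1 so that [gibbs_average] applies to every index. *)
Lemma limit_fiber_pressure (U : set_system nat) (t_ : nat -> X) : UltraFilter U ->
  \oo `<=` U -> exists nu : probability (borel Z) R, invariant_measure G nu /\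
    forall c, (\forall n \near U, c <= fiber_pressure n.+1 (t_ n)) ->
      (c%:E <= fiber_free_energy phi nu)%E.
Proof.
move=> UU ooU.
have /choice[mue hmue] (n : nat) :
  exists mue : (set (borel Z) -> R) * R, [/\ fprob mue.1,
   (forall B, measurable B -> `|mue.1 (G @^-1` B) - mue.1 B| <= n.+1%:R^-1),
   (forall N K, (0 < N)%N -> 2 * C * N%:R <= K%:R ->
     mue.2 <= stairs_integral phi C N K mue.1 + N%:R^-1) &
   forall m, (0 < m)%N -> fiber_pressure n.+1 (t_ n) <=
     m%:R^-1 * ent mue.1 (itin G m base_letter) + mue.2 +
     n.+1%:R^-1 * (2 * #|{: m.-tuple A}|%:R)].
  by have [mu [e h]] := gibbs_average (t_ n) (ltn0Sn n); exists (mu, e).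
have small d : 0 < d -> \forall n \near U, n.+1%:R^-1 <= d :> R.
  move=> d0; apply: ooU; exists (Num.truncn d^-1) => // n /= hn.
  rewrite invf_ple ?posrE//; apply: ltW; apply: (lt_le_trans (truncnS_gt _)).
  by rewrite ler_nat.
have [|B mB||nu [nuG h]] := @limit_free_energy _ U UU (fun n => (mue n).1) (fun n => (mue n).2).
- by move=> n; case: (hmue n).
- apply/cvgrPdist_le => d d0; apply: filterS (small d d0) => n hn.
  rewrite sub0r normrN; apply: le_trans hn; by case: (hmue n) => _ + _ _; apply.
- by move=> N K N0 hK n; case: (hmue n) => _ _ + _; apply.
exists nu; split => // c hc; apply: h => m e m0 e0.
pose B : R := 2 * #|{: m.-tuple A}|%:R + 1.
have B0 : 0 < B by rewrite ltr_wpDl// mulr_ge0.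
apply: filterS (filterI hc (small (e / B) (divr_gt0 e0 B0))) => n [h1 h2].
have [_ _ _ h3] := hmue n; apply: (le_trans h1); apply: (le_trans (h3 m m0)).
rewrite lerD2l; apply: (@le_trans _ _ (n.+1%:R^-1 * B)).
  by rewrite ler_wpM2l ?invr_ge0// lerDl.
by rewrite -ler_pdivlMr.
Qed.

(** The ultrafilter lives on the probabilities themselves and contains every set of invariant
    measures with free energy above a real c below the supremum. Using such c avoids presupposing
    that the supremum is finite. *)
Lemma free_energy_max : exists2 nu : probability (borel Z) R, invariant_measure G nu &
  forall nu' : probability (borel Z) R, invariant_measure G nu' ->
    (fiber_free_energy phi nu' <= fiber_free_energy phi nu)%E.
Proof.
pose V := [set fiber_free_energy phi nu | nu in
  [set nu : probability (borel Z) R | invariant_measure G nu]].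
(* Some invariant measure must exist for [D] to be nonempty; the Gibbs averages over one fixed fibre
   point provide it. *)
have [U0 [UU0 ooU0]] := ultraFilterLemma eventually_filter.
have [nu0 [nu0G _]] := limit_fiber_pressure (fun=> point) UU0 ooU0.
pose D := [set c : R | (c%:E < ereal_sup V)%E].
pose P (c : R) := [set nu : probability (borel Z) R |
  invariant_measure G nu /\ (c%:E < fiber_free_energy phi nu)%E].
have FP : ProperFilter (filter_from D P).
  apply: filter_from_proper; last first.
    by move=> c /ereal_sup_gt[_ [nu nuG <-] h]; exists nu.
  apply: filter_from_filter.
    have [h [hE _ _]] := fiber_free_energyE nu0G.
    exists (h + fine (\int[nu0]_z (phi z)%:E)%E - 1); rewrite /D/=.
    apply: lt_le_trans (ereal_sup_ubound _); last by exists nu0.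
    by rewrite hE lte_fin ltrBlDr ltrDl.
  move=> c c' Dc Dc'; exists (Num.max c c') => /=.
    by rewrite /D/=; case: (leP c c').
  move=> nu [nuG]; rewrite /P/= => h; split; split => //.
    by apply: le_lt_trans h; rewrite lee_fin le_max lexx.
  by apply: le_lt_trans h; rewrite lee_fin le_max lexx orbT.
have [U [UU sU]] := ultraFilterLemma FP.
have nearP c : D c -> U (P c) by move=> Dc; apply: sU; exists c.
have [c0 Dc0] : exists c, D c.
  have : filter_from D P setT by exact: filterT.
  by case=> c Dc _; exists c.
have [|B mB||nu [nuG h]] := @limit_free_energy _ U UU
  (fun nu => fine \o nu) (fun nu => fine (\int[nu]_z (phi z)%:E)%E).
- by move=> nu; exact: fprob_probability.
- apply/cvgrPdist_le => d d0; apply: filterS (nearP _ Dc0) => nu [nuG _].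
  by rewrite /= nuG// subrr subrr normr0 ltW.
- by move=> N K N0 hK nu; have /andP[] := stairs_integral_bounds nu mphi phiC N0 hK.
exists nu => // nu' nu'G; have [h' [h'E _ _]] := fiber_free_energyE nu'G.
rewrite h'E; apply/lee_addgt0Pr => e e0; rewrite -leeBlDr// -EFinB.
(* This c lies strictly below the value at nu', hence below the supremum, so U-almost all measures
   have free energy above c; their n-block entropies are no smaller than their entropies. *)
apply: h => n d n0 d0; set c := _ - e.
have Dc : D c.
  apply: lt_le_trans (ereal_sup_ubound _); last by exists nu'.
  by rewrite h'E lte_fin /c ltrBlDr ltrDl.
apply: filterS (nearP _ Dc) => mu [muG]; have [k [-> k1 _]] := fiber_free_energyE muG.
rewrite lte_fin => ck; have := k1 n n0; lra.
Qed.

Lemma poe_le_free_energy (c : R) : (c%:E < poe F phi)%E ->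
  exists2 nu : probability (borel Z) R, invariant_measure G nu &
    (c%:E <= fiber_free_energy phi nu)%E.
Proof.
move=> hc; pose Q := [set n | exists t, c <= fiber_pressure n.+1 t].
have often N : exists2 n, (N <= n)%N & Q n.
  (* The tail from N + 1 contains only positive lengths, which can be written as a successor as [Q]
     demands. *)
  have : (c%:E < esups (fun n =>
      ereal_sup [set (fiber_pressure n t)%:E | t in [set: X]]) N.+1)%E.
    apply: (lt_le_trans hc); rewrite /poe limn_esup_lim.
    set u := (fun n => _); have -> : limn (esups u) = ereal_inf (range (esups u)).
      by apply/cvg_lim => //; exact: cvg_esups_inf.
    by apply: ereal_inf_lbound; exists N.+1.
  move=> /ereal_sup_gt[_ [n /= Nn <-]] /ereal_sup_gt[_ [t _ <-]]; rewrite lte_fin => h.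
  exists n.-1; first by lia.
  by exists t; rewrite prednK ?ltW//; lia.
(* The limsup is approached only along some lengths, so the ultrafilter has to contain [Q] besides
   refining [\oo]. *)
have FP : ProperFilter (within Q \oo).
  apply: Build_ProperFilter_ex.
  move=> B [N _ hN]; have [n Nn Qn] := often N; exists n; exact: hN.
have [U [UU sU]] := ultraFilterLemma FP.
have ooU : \oo `<=` U.
  by move=> B oB; apply: sU; apply: filterS oB => n Bn _.
have /choice[t_ ht] (n : nat) : exists t, Q n -> c <= fiber_pressure n.+1 t.
  have [[t h]|h] := pselect (Q n); first by exists t.
  by exists point.
have [nu [nuG h]] := limit_fiber_pressure t_ UU ooU; exists nu => //.
apply: h; apply: sU; apply: nearW => n; exact: ht.
Qed.

End skew.

Theorem theorem5p1 (R : realType) (A : finType) (M : transition A)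
    (X : pmetricType R) (alpha : R)
    (F : markov_shift R M -> X -> X)
    (phi : markov_shift R M * X -> R)
    (trM : topologically_transitive (@left_shift R A M))
    (cX : compact [set: X])
    (alpha_gt0 : 0 < alpha) (alpha_le1 : alpha <= 1)
    (hF : hoelder_into_C_alpha alpha F)
    (homF : forall w, homeomorphism (F w))
    (hphi : @hoelder_continuous R (markov_shift R M * X)%type R^o phi) :
  let values : set (\bar R) := [set fiber_free_energy phi nu | nu in
    [set nu : probability (borel (markov_shift R M * X)%type) R |
      invariant_measure
        (skew_product F : borel (markov_shift R M * X)%type ->
                          borel (markov_shift R M * X)%type) nu]] in
  exists max_value : \bar R,
    [/\ values max_value, ubound values max_value &
        (poe F phi <= max_value)%E].
Proof.
move=> values; have [nu nuG numax] := free_energy_max cX alpha_gt0 hF hphi.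
exists (fiber_free_energy phi nu); split; first by exists nu.
  by move=> _ [nu' nu'G <-]; exact: numax.
have [h [hE _ _]] := fiber_free_energyE cX hphi nuG.
rewrite leNgt; apply/negP => lt.
(* The maximum is finite by [hE], but [poe] may a priori be +oo, so the separating real number is
   chosen by cases. *)
have [c cpoe hc] : exists2 c : R,
    (c%:E < poe F phi)%E & (fiber_free_energy phi nu < c%:E)%E.
  move: lt; rewrite hE; case: (poe F phi) => [r| |//]; last first.
    by move=> _; exists (h + fine (\int[nu]_z (phi z)%:E)%E + 1); rewrite ?ltry// lte_fin ltrDl.
  rewrite lte_fin => /midf_lt[lt1 lt2].
  by exists ((h + fine (\int[nu]_z (phi z)%:E)%E + r) / 2); rewrite lte_fin.
have [nu' nu'G hnu'] := poe_le_free_energy cX alpha_gt0 hF hphi cpoe.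
by have := lt_le_trans hc (le_trans hnu' (numax _ nu'G)); rewrite ltxx.
Qed.
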